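(* Let $\mathcal C$ be a small category satisfying the nine axioms (A1)–(A9). Then $\mathcal C$ is isomorphic (as a category) to the prefix–suffix matching category (expression tree category) $\mathcal C_L$ of its derived finite-arity signature \[ L=\Phi,\qquad \operatorname{ar}(\phi)=|\operatorname{Comp}(\phi)|. \] The isomorphism identifies all morphisms of $\mathcal C$ with prefix–suffix matchings, the strong monomorphisms with specified occurrences of entire subtrees, and the epimorphisms with pruning maps. Conversely, for every ranked set $L$ the expression tree category $\mathcal C_L$ satisfies the nine axioms (A1)–(A9).
   Context: AXIOMS. Let $\mathcal C$ be a small category. A monomorphism $m:A\to B$ is strong if for every epimorphism $e:P\to Q$ and all $a:P\to A$, $b:Q\to B$ with $ma=be$ there is $\ell:Q\to A$ with $\ell e=a$ and $m\ell=b$. The nine axioms are: (A1) There is a terminal object $1$ (fixed); $q_X:X\to 1$ is the unique morphism, and a point of $Y$ is a morphism $1\to Y$. (A2) Every morphism factors as $me$ with $e$ an epimorphism and $m$ a strong monomorphism. (A3) For every epimorphism $d:X\to Y$ and strong monomorphism $v:B\to Y$ the pullback of $d$ and $v$ exists and its projection to $B$ is an epimorphism. (A4) For every strong monomorphism $u:A\to X$ and epimorphism $a:A\to B$ there is a pushout square $cu=va$ ($c:X\to Y$, $v:B\to Y$) with $v$ a strong monomorphism, and this square is also a pullback. (A5) The class of epimorphisms whose pullbacks along all but at most one point of their codomain are isomorphisms is stable under pushout along strong monomorphisms. (A6) For every object $A$ and point $j:1\to B$ the category $\mathcal F(A,j)$ has a terminal object. Its objects are triples $(C,d,u)$ with $u:A\to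 C$ a strong monomorphism and $d:C\to B$ an epimorphism such that the square $du=jq_A$ is a pullback; its morphisms $(C',d',u')\to(C,d,u)$ are morphisms $h:C'\to C$ with $hu'=u$ and $dh=d'$. (A7) For every object $X$ there are finitely many strong monomorphisms with codomain $X$ and finitely many epimorphisms with domain $X$ (counted as individual arrows, with all possible other endpoints). (A8) For every commutative square of strong monomorphisms $ca=db$ ($a:W\to X$, $b:W\to Y$, $c:X\to Z$, $d:Y\to Z$) there is $h:X\to Y$ with $ha=b$, $dh=c$, or there is $k:Y\to X$ with $kb=a$, $ck=d$. (A9) If the pullback of an epimorphism $d:X\to Y$ along every point of $Y$ is an isomorphism, then $d$ is an identity. Here ''the pullback of $d$ along a point $j:1\to Y$'' is the projection $X\times_Y1\to1$. DERIVED SIGNATURE. Under the axioms, a strong monomorphism $i:A\to X$ is indecomposable if it is not an identity and whenever $i=vu$ with $u,v$ strong monomorphisms, $u$ or $v$ is an identity; $\operatorname{Comp}(X)$ is the set of indecomposable strong monomorphisms with codomain $X$. Let $\mathcal E^\circ$ consist of the epimorphisms with codomain $\ne 1$ together with $\mathrm{id}_1$. An object is normal if its only outgoing morphism in $\mathcal E^\circ$ is its identity. Every object $X$ has a unique morphism $\rho_X:X\to r(X)$ in $\mathcal E^\circ$ with normal target. The set of root labels is $\Phi=\{\phi\neq 1: r(\phi)=\phi\}$ (the normal objects other than $1$), with input-place set $P_\phi=\operatorname{Comp}(\phi)$ (all of whose members are morphisms $1\to\phi$) and arity $\operatorname{ar}(\phi)=|\operatorname{Comp}(\phi)|$; a bijection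 of $P_\phi$ with $\{1,\dots,\operatorname{ar}(\phi)\}$ is chosen for each $\phi$ in order to present $\mathcal C_\Phi$ as below. EXPRESSION TREE CATEGORIES. A ranked set (finite-arity signature) is a set $L$ with a function $\operatorname{ar}:L\to\mathbb N$ (arity $0$ allowed). Trees over $L$ are defined recursively: the empty leaf $1$ is a tree, and for $\lambda\in L$ with $n=\operatorname{ar}(\lambda)$ and trees $T_1,\dots,T_n$ there is a tree $\lambda(T_1,\dots,T_n)$; equality is syntactic. Positions are addresses (finite words): $\operatorname{Pos}(1)=\{()\}$, and $\operatorname{Pos}(\lambda(T_1,\dots,T_n))$ consists of the empty word $()$ and the words $pb$ with $1\le p\le n$, $b\in\operatorname{Pos}(T_p)$; $X|_a$ is the entire subtree of $X$ at $a$. An occurrence (subtree embedding) $A\to X$ is a position $a$ of $X$ with $X|_a=A$; occurrences compose by concatenating addresses. A tree $T$ is obtainable from $X$ by pruning if $T=1$, or $X=\lambda(X_1,\dots,X_n)$ and $T=\lambda(T_1,\dots,T_n)$ with each $T_p$ obtainable from $X_p$; in this case there is exactly one pruning map $d:X\to T$, otherwise none. Then $\operatorname{Pos}(T)\subseteq\operatorname{Pos}(X)$ and $p_d:\operatorname{Pos}(X)\to\operatorname{Pos}(T)$ sends a position to its longest prefix in $\operatorname{Pos}(T)$. The category $\mathcal C_L$ has the trees as objects; a morphism $X\to Y$ (a prefix–suffix matching) is a pair $(d,u)$ of a pruning map $d:X\to T$ and an occurrence $u:T\to Y$. For $(d,u):X\to Y$ with $u$ at address $a$ and $(e,v):Y\to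 Z$ with $e:Y\to S$, the composite is $(e_ad,\,vu')$, where $u'$ is the occurrence of $S|_{p_e(a)}$ in $S$ at $p_e(a)$ and $e_a:Y|_a\to S|_{p_e(a)}$ is the pruning map (which exists). The identity of $X$ is the pair of the identity pruning and the occurrence of the whole tree. Pruning maps and occurrences are regarded as the matchings whose other component is an identity. *)

(* Defs.v *)
From HB Require Import structures.
From mathcomp Require Import all_boot.
From mathcomp Require Import finmap.
From mathcomp Require Import boolp classical_sets functions cardinality.

Set Implicit Arguments.
Unset Strict Implicit.
Unset Printing Implicit Defensive.

Declare Scope cat_scope.
Delimit Scope cat_scope with cat.

Record category : Type := Category {
  obj :> Type;
  hom : obj -> obj -> Type;
  idm : forall X, hom X X;
  comp : forall X Y Z, hom Y Z -> hom X Y -> hom X Z;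
  comp_idl : forall X Y (f : hom X Y), comp (idm Y) f = f;
  comp_idr : forall X Y (f : hom X Y), comp f (idm X) = f;
  comp_assoc : forall X Y Z W (h : hom Z W) (g : hom Y Z) (f : hom X Y),
    comp h (comp g f) = comp (comp h g) f }.

Arguments hom {c} X Y.
Arguments idm {c} X.
Arguments comp {c X Y Z} g f.

Notation "g ∘ f" := (comp g f) (at level 40, left associativity) : cat_scope.
Local Open Scope cat_scope.

Record functor (C D : category) : Type := Functor {
  fobj :> C -> D;
  fmap : forall X Y : C, hom X Y -> hom (fobj X) (fobj Y);
  fmap_id : forall X : C, fmap (idm X) = idm (fobj X);
  fmap_comp : forall (X Y Z : C) (g : hom Y Z) (f : hom X Y),
    fmap (g ∘ f) = fmap g ∘ fmap f }.

Arguments fmap {C D} f {X Y} _ : rename.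

Definition functor_id (C : category) : functor C C :=
  @Functor C C id (fun _ _ f => f) (fun _ => erefl) (fun _ _ _ _ _ => erefl).

Lemma functor_comp_id (C D E : category) (G : functor D E) (F : functor C D)
  (X : C) : fmap G (fmap F (idm X)) = idm (G (F X)).
Proof. by rewrite !fmap_id. Qed.

Lemma functor_comp_comp (C D E : category) (G : functor D E) (F : functor C D)
  (X Y Z : C) (g : hom Y Z) (f : hom X Y) :
  fmap G (fmap F (g ∘ f)) = fmap G (fmap F g) ∘ fmap G (fmap F f).
Proof. by rewrite !fmap_comp. Qed.

Definition functor_comp (C D E : category) (G : functor D E) (F : functor C D) :
    functor C E :=
  @Functor C E (fun X => G (F X)) (fun _ _ f => fmap G (fmap F f))
    (functor_comp_id G F) (functor_comp_comp G F).

Definition is_cat_iso (C D : category) (F : functor C D) : Prop :=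
  exists G : functor D C,
    functor_comp G F = functor_id C /\ functor_comp F G = functor_id D.

(* An inductive family, because source and target of an identity coincide only
   propositionally. *)
Inductive is_identity (C : category) : forall X Y : C, hom X Y -> Prop :=
  Is_identity (X : C) : is_identity (idm X).

Definition is_iso (C : category) (X Y : C) (f : hom X Y) : Prop :=
  exists g : hom Y X, g ∘ f = idm X /\ f ∘ g = idm Y.

Definition mono (C : category) (A B : C) (m : hom A B) : Prop :=
  forall (W : C) (f g : hom W A), m ∘ f = m ∘ g -> f = g.

Definition epi (C : category) (A B : C) (e : hom A B) : Prop :=
  forall (W : C) (f g : hom B W), f ∘ e = g ∘ e -> f = g.

Definition strong_mono (C : category) (A B : C) (m : hom A B) : Prop :=
  mono m /\
  forall (P Q : C) (e : hom P Q) (a : hom P A) (b : hom Q B),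
    epi e -> m ∘ a = b ∘ e -> exists l : hom Q A, l ∘ e = a /\ m ∘ l = b.

Definition is_terminal (C : category) (T : C) : Prop :=
  forall X : C, exists q : hom X T, forall q' : hom X T, q' = q.

(* p : P -> X and q : P -> Y are the projections of a pullback of f and g. *)
Definition is_pullback (C : category) (X Y Z P : C)
    (f : hom X Z) (g : hom Y Z) (p : hom P X) (q : hom P Y) : Prop :=
  f ∘ p = g ∘ q /\
  forall (W : C) (a : hom W X) (b : hom W Y), f ∘ a = g ∘ b ->
    exists! h : hom W P, p ∘ h = a /\ q ∘ h = b.

(* c : X -> Q and v : Y -> Q are the injections of a pushout of f and g. *)
Definition is_pushout (C : category) (Z X Y Q : C)
    (f : hom Z X) (g : hom Z Y) (c : hom X Q) (v : hom Y Q) : Prop :=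
  c ∘ f = v ∘ g /\
  forall (W : C) (a : hom X W) (b : hom Y W), a ∘ f = b ∘ g ->
    exists! h : hom Q W, h ∘ c = a /\ h ∘ v = b.

(* For an epimorphism d the pullback exists by A3, points being strong
   monomorphisms, so "some pullback" and "every pullback" mean the same. *)
Definition pullback_iso_at (C : category) (one X Y : C)
    (d : hom X Y) (j : hom one Y) : Prop :=
  exists (P : C) (p : hom P X) (q : hom P one), is_pullback d j p q /\ is_iso q.

Definition one_point_epi (C : category) (one X Y : C) (d : hom X Y) : Prop :=
  epi d /\
  forall j j' : hom one Y,
    ~ pullback_iso_at d j -> ~ pullback_iso_at d j' -> j = j'.

(* The objects (C, d, u) of F(A, j); in fill_pb, q ranges over the only
   morphism A -> 1. *)
Record fill_obj (C : category) (one A B : C) (j : hom one B) : Type := FillObj {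
  fill_dom : C;
  fill_d : hom fill_dom B;
  fill_u : hom A fill_dom;
  fill_epi : epi fill_d;
  fill_strong : strong_mono fill_u;
  fill_pb : forall q : hom A one, is_pullback fill_d j fill_u q }.

Definition fill_hom (C : category) (one A B : C) (j : hom one B)
    (S T : fill_obj A j) : Type :=
  {h : hom (fill_dom S) (fill_dom T) |
    h ∘ fill_u S = fill_u T /\ fill_d T ∘ h = fill_d S}.

Lemma fill_hom_eq (C : category) (one A B : C) (j : hom one B)
  (S T : fill_obj A j) (f g : fill_hom S T) : sval f = sval g -> f = g.
Proof.
case: f g => f pf [g pg] /= fg; subst g.
by rewrite (Prop_irrelevance pf pg).
Qed.

Lemma fill_id_proof (C : category) (one A B : C) (j : hom one B)
  (S : fill_obj A j) :
  idm (fill_dom S) ∘ fill_u S = fill_u S /\ fill_d S ∘ idm (fill_dom S) = fill_d S.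
Proof. by rewrite comp_idl comp_idr. Qed.

Definition fill_id (C : category) (one A B : C) (j : hom one B)
    (S : fill_obj A j) : fill_hom S S :=
  exist _ (idm (fill_dom S)) (fill_id_proof S).

Lemma fill_comp_proof (C : category) (one A B : C) (j : hom one B)
  (S T U : fill_obj A j) (g : fill_hom T U) (f : fill_hom S T) :
  (sval g ∘ sval f) ∘ fill_u S = fill_u U /\
  fill_d U ∘ (sval g ∘ sval f) = fill_d S.
Proof.
case: g f => g [gu dg] [f [fu df]] /=.
by rewrite -comp_assoc fu gu comp_assoc dg df.
Qed.

Definition fill_comp (C : category) (one A B : C) (j : hom one B)
    (S T U : fill_obj A j) (g : fill_hom T U) (f : fill_hom S T) : fill_hom S U :=
  exist _ (sval g ∘ sval f) (fill_comp_proof g f).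

Lemma fill_idl (C : category) (one A B : C) (j : hom one B)
  (S T : fill_obj A j) (f : fill_hom S T) : fill_comp (fill_id T) f = f.
Proof. by apply: fill_hom_eq; exact: comp_idl. Qed.

Lemma fill_idr (C : category) (one A B : C) (j : hom one B)
  (S T : fill_obj A j) (f : fill_hom S T) : fill_comp f (fill_id S) = f.
Proof. by apply: fill_hom_eq; exact: comp_idr. Qed.

Lemma fill_assoc (C : category) (one A B : C) (j : hom one B)
  (S T U V : fill_obj A j)
  (h : fill_hom U V) (g : fill_hom T U) (f : fill_hom S T) :
  fill_comp h (fill_comp g f) = fill_comp (fill_comp h g) f.
Proof. by apply: fill_hom_eq; exact: comp_assoc. Qed.

Definition fill_cat (C : category) (one A B : C) (j : hom one B) : category :=
  Category (@fill_idl C one A B j) (@fill_idr C one A B j)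
    (@fill_assoc C one A B j).

Record nine_axioms (C : category) (one : C) : Prop := NineAxioms {
  A1 : is_terminal one;
  A2 : forall (X Y : C) (f : hom X Y),
    exists (I : C) (e : hom X I) (m : hom I Y),
      [/\ epi e, strong_mono m & f = m ∘ e];
  A3 : forall (X Y B : C) (d : hom X Y) (v : hom B Y),
    epi d -> strong_mono v ->
    exists (P : C) (p : hom P X) (q : hom P B), is_pullback d v p q /\ epi q;
  A4 : forall (A X B : C) (u : hom A X) (a : hom A B),
    strong_mono u -> epi a ->
    exists (Y : C) (c : hom X Y) (v : hom B Y),
      [/\ is_pushout u a c v, strong_mono v & is_pullback c v u a];
  A5 : forall (A B X Y : C) (a : hom A B) (u : hom A X) (c : hom X Y) (v : hom B Y),
    one_point_epi one a -> strong_mono u -> is_pushout u a c v ->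
    one_point_epi one c;
  A6 : forall (A B : C) (j : hom one B),
    exists T : fill_cat A j, is_terminal T;
  A7 : forall X : C,
    finite_set [set m : {A : C & hom A X} | strong_mono (projT2 m)] /\
    finite_set [set e : {B : C & hom X B} | epi (projT2 e)];
  A8 : forall (W X Y Z : C)
      (a : hom W X) (b : hom W Y) (c : hom X Z) (d : hom Y Z),
    strong_mono a -> strong_mono b -> strong_mono c -> strong_mono d ->
    c ∘ a = d ∘ b ->
    (exists h : hom X Y, h ∘ a = b /\ d ∘ h = c) \/
    (exists k : hom Y X, k ∘ b = a /\ c ∘ k = d);
  A9 : forall (X Y : C) (d : hom X Y),
    epi d -> (forall j : hom one Y, pullback_iso_at d j) -> is_identity d }.

Definition indecomposable (C : category) (A X : C) (i : hom A X) : Prop :=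
  [/\ strong_mono i, ~ is_identity i &
    forall (B : C) (u : hom A B) (v : hom B X),
      strong_mono u -> strong_mono v -> i = v ∘ u ->
      is_identity u \/ is_identity v].

Definition Comp (C : category) (X : C) : set {A : C & hom A X} :=
  [set i : {A : C & hom A X} | indecomposable (projT2 i)].

Arguments Comp {C} X.

Definition Ecirc (C : category) (one X Y : C) (d : hom X Y) : Prop :=
  (epi d /\ Y <> one) \/ (Y = one /\ is_identity d).

Definition normal (C : category) (one X : C) : Prop :=
  forall (Y : C) (d : hom X Y), Ecirc one d -> is_identity d.

(* The morphism rho_X, packed with its target r(X). Under the nine axioms the
   set below is a singleton, so neither the choice made by xget nor its default
   value matters. *)
Definition rho (C : category) (one X : C) : {N : C & hom X N} :=
  xget (existT _ X (idm X) : {classic {N : C & hom X N}})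
    [set d : {N : C & hom X N} | Ecirc one (projT2 d) /\ normal one (projT1 d)].

Definition r (C : category) (one X : C) : C := projT1 (rho one X).

Definition Phi (C : category) (one : C) : Type :=
  {phi : C | phi <> one /\ r one phi = phi}.

(* fset_set sends a finite set to the corresponding finite set structure, and
   an infinite one to fset0; Comp phi is finite by A7. *)
Definition Phi_ar (C : category) (one : C) (phi : Phi one) : nat :=
  #|` fset_set (Comp (sval phi) : set {classic {A : C & hom A (sval phi)}})|.

Inductive tree (L : Type) (ar : L -> nat) : Type :=
  | leaf
  | node (l : L) (T : 'I_(ar l) -> tree ar).

Arguments leaf {L ar}.
Arguments node {L ar} l T.

(* An address is a word of input places, and the places of a node of arity n
   are numbered 0, ..., n - 1. *)
Fixpoint pos (L : Type) (ar : L -> nat) (X : tree ar) (a : seq nat)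
    {struct a} : bool :=
  match a, X with
  | [::], _ => true
  | p :: b, node l T => if insub p is Some i then pos (T i) b else false
  | _ :: _, leaf => false
  end.

(* The entire subtree of X at a; the value is irrelevant unless pos X a. *)
Fixpoint subtree (L : Type) (ar : L -> nat) (X : tree ar) (a : seq nat)
    {struct a} : tree ar :=
  match a, X with
  | [::], _ => X
  | p :: b, node l T => if insub p is Some i then subtree (T i) b else leaf
  | _ :: _, leaf => leaf
  end.

Inductive prunes (L : Type) (ar : L -> nat) : tree ar -> tree ar -> Prop :=
  | prunes_leaf (X : tree ar) : prunes X leaf
  | prunes_node (l : L) (X T : 'I_(ar l) -> tree ar) :
      (forall p, prunes (X p) (T p)) -> prunes (node l X) (node l T).

(* The longest prefix of a in Pos(T), as proved in pos_lpP. For a pruning map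
   d : X -> T this is p_d(a). *)
Fixpoint pos_lp (L : Type) (ar : L -> nat) (T : tree ar) (a : seq nat)
    {struct a} : seq nat :=
  match a, T with
  | p :: b, node l U => if insub p is Some i then p :: pos_lp (U i) b else [::]
  | _, _ => [::]
  end.

Lemma pos_lpP (L : Type) (ar : L -> nat) (T : tree ar) (a : seq nat) :
  [/\ prefix (pos_lp T a) a, pos T (pos_lp T a) &
      forall b, prefix b a -> pos T b -> prefix b (pos_lp T a)].
Proof.
elim: a T => [|p a IH] [|l U] /=.
- by split=> // - [].
- by split=> // - [].
- by split=> // - [|q b].
case E: (insub p) => [i|].
  have [h1 h2 h3] := IH (U i); split; rewrite /= ?eqxx ?E //.
  by move=> [|q b] //=; case: eqP => //= -> hb; rewrite E; exact: h3.
by split=> // - [|q b] //=; case: eqP => //= ->; rewrite E.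
Qed.

Record occurrence (L : Type) (ar : L -> nat) (A X : tree ar) : Type := Occurrence {
  address : seq nat;
  address_pos : pos X address;
  address_sub : subtree X address = A }.

(* There is at most one pruning map X -> T, so it is recorded as a proof of the
   proposition prunes X T. *)
Record matching (L : Type) (ar : L -> nat) (X Y : tree ar) : Type := Matching {
  mid : tree ar;
  match_prune : prunes X mid;
  match_occ : occurrence mid Y }.

Definition match_address (L : Type) (ar : L -> nat) (X Y : tree ar)
  (m : matching X Y) : seq nat := address (match_occ m).

Lemma matching_eq (L : Type) (ar : L -> nat) (X Y : tree ar) (m n : matching X Y) :
  match_address m = match_address n -> m = n.
Proof.
case: m n => [T dT [a pa sa]] [S dS [b pb sb]]; rewrite /match_address /= => eab.
subst b; subst T; subst S.
by rewrite (Prop_irrelevance dT dS) (Prop_irrelevance pa pb).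
Qed.

Lemma prunes_refl (L : Type) (ar : L -> nat) (X : tree ar) : prunes X X.
Proof. by elim: X => [|l T IH]; constructor. Qed.

Lemma prunes_nodeE (L : Type) (ar : L -> nat) (X : tree ar) (l : L)
  (T : 'I_(ar l) -> tree ar) : prunes X (node l T) ->
  exists2 U : 'I_(ar l) -> tree ar, X = node l U & forall p, prunes (U p) (T p).
Proof.
suff H Y : prunes X Y -> match Y with
    | leaf => True
    | node l T => exists2 U : 'I_(ar l) -> tree ar,
        X = node l U & forall p, prunes (U p) (T p)
    end by move/H.
by case=> // k U V UV; exists U.
Qed.

Lemma prunes_trans (L : Type) (ar : L -> nat) (X Y Z : tree ar) :
  prunes X Y -> prunes Y Z -> prunes X Z.
Proof.
move=> + YZ; elim: YZ X => [{}Y|l U V _ IH] X; first by constructor.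
move=> XU; have [W -> WU] := prunes_nodeE XU.
by constructor => p; exact: IH.
Qed.

(* The pruning map e_a : Y|_a -> S|_{p_e(a)} exists. *)
Lemma prunes_subtree (L : Type) (ar : L -> nat) (Y S : tree ar) (a : seq nat) :
  prunes Y S -> pos Y a -> prunes (subtree Y a) (subtree S (pos_lp S a)).
Proof.
elim: a Y S => [|p a IH] Y S YS; first by [].
case: YS => [|l U V UV] /=; first by case: Y => *; constructor.
case E: (insub p) => [i|//]; rewrite /= E => pa.
exact: IH.
Qed.

Lemma pos_cat (L : Type) (ar : L -> nat) (X : tree ar) (a b : seq nat) :
  pos X a -> pos (subtree X a) b -> pos X (a ++ b).
Proof. by elim: a X => [|p a IH] [|l U] //=; case: insub => // i; exact: IH. Qed.

Lemma subtree_cat (L : Type) (ar : L -> nat) (X : tree ar) (a b : seq nat) :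
  pos X a -> subtree X (a ++ b) = subtree (subtree X a) b.
Proof. by elim: a X => [|p a IH] [|l U] //=; case: insub => // i; exact: IH. Qed.

Lemma pos_lp_id (L : Type) (ar : L -> nat) (X : tree ar) (a : seq nat) :
  pos X a -> pos_lp X a = a.
Proof.
by elim: a X => [|p a IH] [|l U] //=; case: insub => // i /IH ->.
Qed.

Lemma pos_lp_leaf (L : Type) (ar : L -> nat) (a : seq nat) :
  pos_lp (@leaf L ar) a = [::].
Proof. by case: a. Qed.

Lemma pos_lp_cat (L : Type) (ar : L -> nat) (Z R : tree ar) (b a : seq nat) :
  prunes Z R -> pos Z b ->
  pos_lp R (b ++ pos_lp (subtree Z b) a) =
  pos_lp R b ++ pos_lp (subtree R (pos_lp R b)) a.
Proof.
elim: b Z R => [|p b IH] Z R ZR /=.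
  move=> _; elim: a Z R ZR => [|p a IHa] Z R //.
  case=> [{}Z|l U V UV] /=; first by rewrite !pos_lp_leaf.
  case E: (insub p) => [i|] //=.
  by rewrite E IHa.
case: ZR => [{}Z|l U V UV] /=; first by rewrite !pos_lp_leaf.
case E: (insub p) => [i|] //= pb.
by rewrite E /= IH.
Qed.

Lemma subtree_nil (L : Type) (ar : L -> nat) (X : tree ar) : subtree X [::] = X.
Proof. by case: X. Qed.

Lemma pos_nil (L : Type) (ar : L -> nat) (X : tree ar) : pos X [::].
Proof. by case: X. Qed.

Definition occ_whole (L : Type) (ar : L -> nat) (X : tree ar) : occurrence X X :=
  Occurrence (pos_nil X) (subtree_nil X).

Definition matching_id (L : Type) (ar : L -> nat) (X : tree ar) : matching X X :=
  Matching (prunes_refl X) (occ_whole X).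

Lemma occ_comp_pos (L : Type) (ar : L -> nat) (A B X : tree ar)
  (v : occurrence B X) (u : occurrence A B) : pos X (address v ++ address u).
Proof.
case: v u => b pb sb [a pa sa] /=; apply: pos_cat => //.
by rewrite sb.
Qed.

Lemma occ_comp_sub (L : Type) (ar : L -> nat) (A B X : tree ar)
  (v : occurrence B X) (u : occurrence A B) :
  subtree X (address v ++ address u) = A.
Proof.
by case: v u => b pb sb [a pa sa] /=; rewrite subtree_cat // sb.
Qed.

Definition occ_comp (L : Type) (ar : L -> nat) (A B X : tree ar)
    (v : occurrence B X) (u : occurrence A B) : occurrence A X :=
  Occurrence (occ_comp_pos v u) (occ_comp_sub v u).

Lemma pos_pos_lp (L : Type) (ar : L -> nat) (T : tree ar) (a : seq nat) :
  pos T (pos_lp T a).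
Proof. by case: (pos_lpP T a). Qed.

Definition occ_image (L : Type) (ar : L -> nat) (S : tree ar) (a : seq nat) :
    occurrence (subtree S (pos_lp S a)) S :=
  Occurrence (pos_pos_lp S a) erefl.

Lemma matching_comp_prune (L : Type) (ar : L -> nat) (X Y Z : tree ar)
  (g : matching Y Z) (f : matching X Y) :
  prunes X (subtree (mid g) (pos_lp (mid g) (match_address f))).
Proof.
case: g f => S e v [T d [a pa sa]]; rewrite /match_address /=.
by apply: (prunes_trans d); rewrite -sa; exact: prunes_subtree.
Qed.

Definition matching_comp (L : Type) (ar : L -> nat) (X Y Z : tree ar)
    (g : matching Y Z) (f : matching X Y) : matching X Z :=
  Matching (matching_comp_prune g f)
    (occ_comp (match_occ g) (occ_image (mid g) (match_address f))).

Lemma matching_idl (L : Type) (ar : L -> nat) (X Y : tree ar)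
  (f : matching X Y) : matching_comp (matching_id Y) f = f.
Proof.
case: f => T d [a pa sa]; apply: matching_eq; rewrite /match_address /=.
exact: pos_lp_id.
Qed.

Lemma matching_idr (L : Type) (ar : L -> nat) (X Y : tree ar)
  (f : matching X Y) : matching_comp f (matching_id X) = f.
Proof.
case: f => T d [a pa sa]; apply: matching_eq; rewrite /match_address /=.
exact: cats0.
Qed.

Lemma matching_assoc (L : Type) (ar : L -> nat) (X Y Z W : tree ar)
  (h : matching Z W) (g : matching Y Z) (f : matching X Y) :
  matching_comp h (matching_comp g f) = matching_comp (matching_comp h g) f.
Proof.
case: h g f => R k [c pc sc] [S e [b pb sb]] [T d [a pa sa]].
apply: matching_eq; rewrite /match_address /= -catA; congr (_ ++ _).
change (pos_lp R (b ++ pos_lp S a) =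
  pos_lp R b ++ pos_lp (subtree R (pos_lp R b)) a).
by rewrite -sb; exact: pos_lp_cat.
Qed.

Definition tree_cat (L : Type) (ar : L -> nat) : category :=
  Category (@matching_idl L ar) (@matching_idr L ar) (@matching_assoc L ar).

(* The pruning component of m is the identity pruning of X. *)
Definition is_occurrence (L : Type) (ar : L -> nat) (X Y : tree ar)
  (m : matching X Y) : Prop := mid m = X.

(* The occurrence component of m is the occurrence of the whole tree Y. *)
Definition is_pruning (L : Type) (ar : L -> nat) (X Y : tree ar)
  (m : matching X Y) : Prop := match_address m = [::].

(* Main.v *)
(* A category satisfying the axioms is rebuilt from its normal objects. Every
   proper epimorphism factors through the collapse X -> X/A of a fibre A, and A8
   makes these collapses locally confluent away from 1; hence every X <> 1 has a
   unique normal quotient phi <> 1, whose only strong subobjects are itself and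
   its points. By A6, X is determined by the fibres of X -> phi, which may be
   prescribed arbitrarily, so the objects are the trees over Phi. A morphism
   into X is either an epimorphism or factors through exactly one fibre; descending
   through the fibres reads off an address, and an epimorphism is determined by
   its source and target. Thus the morphisms X -> Y are the addresses a of Y such
   that X prunes to the subtree of Y at a. *)

Require Import Defs.
From mathcomp Require Import all_boot.
From mathcomp Require Import finmap.
From mathcomp Require Import boolp classical_sets functions cardinality.

Set Implicit Arguments.
Unset Strict Implicit.
Unset Printing Implicit Defensive.

Local Open Scope cat_scope.

(** * Morphisms and fibres in a category *)

(** Every object collapses onto 1, so a normal quotient is unique only once 1 is excluded; this is
    why [<> one] accompanies the confluence statements. A8 is needed exactly where the obvious
    common quotient of two collapses degenerates to 1. By A9 every isomorphism is an identity, so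
    whatever is built uniquely up to isomorphism is unique on the nose. A5 confines the effect of a
    collapse inside one fibre to that fibre; hence fibres can be prescribed or replaced one point at
    a time. The functor runs from trees to the category, since recursion is available on trees. It
    involves arbitrary choices at each node and for each address, but a morphism is determined by
    its address, so functoriality reduces to computing the address of a composite. The functor is
    inverted at the end, being bijective on objects and fully faithful. *)

Section Morphisms.
Variable C : category.
Implicit Types W X Y Z A B : C.

Lemma epi_comp X Y Z (g : hom Y Z) (f : hom X Y) :
  epi f -> epi g -> epi (g ∘ f).
Proof. by move=> ef eg W a b; rewrite !comp_assoc => /ef /eg. Qed.

Lemma epi_cancel X Y Z (g : hom Y Z) (f : hom X Y) : epi (g ∘ f) -> epi g.
Proof. by move=> e W a b h; apply: e; rewrite !comp_assoc h. Qed.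

Lemma mono_cancel X Y Z (g : hom Y Z) (f : hom X Y) : mono (g ∘ f) -> mono f.
Proof. by move=> m W a b h; apply: m; rewrite -!comp_assoc h. Qed.

Lemma iso_id X : is_iso (idm X).
Proof. by exists (idm X); rewrite comp_idl. Qed.

Lemma iso_sym X Y (f : hom X Y) :
  is_iso f -> exists2 g : hom Y X, is_iso g & g ∘ f = idm X /\ f ∘ g = idm Y.
Proof. by case=> g [gf fg]; exists g => //; exists f. Qed.

Lemma iso_comp X Y Z (g : hom Y Z) (f : hom X Y) :
  is_iso f -> is_iso g -> is_iso (g ∘ f).
Proof.
move=> [f' [f'f ff']] [g' [g'g gg']]; exists (f' ∘ g'); split.
  by rewrite comp_assoc -(comp_assoc f') g'g comp_idr.
by rewrite comp_assoc -(comp_assoc g) ff' comp_idr.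
Qed.

Lemma iso_epi X Y (f : hom X Y) : is_iso f -> epi f.
Proof.
move=> [g [_ fg]] W a b /(congr1 (fun h => h ∘ g)).
by rewrite -!comp_assoc fg !comp_idr.
Qed.

Lemma iso_mono X Y (f : hom X Y) : is_iso f -> mono f.
Proof.
move=> [g [gf _]] W a b /(congr1 (fun h => g ∘ h)).
by rewrite !comp_assoc gf !comp_idl.
Qed.

Lemma iso_strong X Y (f : hom X Y) : is_iso f -> strong_mono f.
Proof.
move=> fi; split; first exact: iso_mono.
case: (fi) => g [gf fg] P Q e a b _ ab; exists (g ∘ b).
by rewrite -comp_assoc -ab !comp_assoc gf fg !comp_idl.
Qed.

Lemma epi_strong_iso X Y (f : hom X Y) : epi f -> strong_mono f -> is_iso f.
Proof.
move=> ef [_ /(_ X Y f (idm X) (idm Y) ef)].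
by rewrite comp_idl comp_idr => -[] // l [lf fl]; exists l.
Qed.

Lemma split_mono_epi_iso X Y (f : hom X Y) (g : hom Y X) :
  epi f -> g ∘ f = idm X -> is_iso f.
Proof.
move=> ef gf; exists g; split=> //; apply: ef.
by rewrite -comp_assoc gf comp_idl comp_idr.
Qed.

Lemma strong_comp X Y Z (g : hom Y Z) (f : hom X Y) :
  strong_mono f -> strong_mono g -> strong_mono (g ∘ f).
Proof.
move=> [mf sf] [mg sg]; split=> [W a b|P Q e a b ee].
  by rewrite -!comp_assoc => /mg /mf.
rewrite -comp_assoc => /(sg _ _ _ _ _ ee) [l [/esym le gl]].
have [k [ke fk]] := sf _ _ _ _ _ ee le.
by exists k; rewrite -comp_assoc fk.
Qed.

Lemma strong_cancel X Y Z (g : hom Y Z) (f : hom X Y) :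
  strong_mono (g ∘ f) -> strong_mono f.
Proof.
move=> [m s]; split=> [|P Q e a b ee ab]; first exact: mono_cancel m.
have [|l [le gfl]] := s P Q e a (g ∘ b) ee.
  by rewrite -!comp_assoc ab.
by exists l; split=> //; apply: ee; rewrite -comp_assoc le.
Qed.

Section Pullback.
Variables (X Y Z P : C) (f : hom X Z) (g : hom Y Z) (p : hom P X) (q : hom P Y).
Hypothesis pb : is_pullback f g p q.

Lemma pullback_jointly_monic W (a b : hom W P) :
  p ∘ a = p ∘ b -> q ∘ a = q ∘ b -> a = b.
Proof.
case: pb => fg u pab qab.
have [|h [_ hu]] := u W (p ∘ a) (q ∘ a); first by rewrite !comp_assoc fg.
by rewrite -(hu a) // -(hu b).
Qed.

Lemma pullback_strong : strong_mono g -> strong_mono p.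
Proof.
case: (pb) => fg u [mg sg].
have mp : mono p.
  move=> W a b ab; apply: pullback_jointly_monic => //; apply: mg.
  by rewrite !comp_assoc -fg -!comp_assoc ab.
split=> // R S e a b ee ab.
have [|l [le gl]] := sg _ _ _ (q ∘ a) (f ∘ b) ee.
  by rewrite comp_assoc -fg -!comp_assoc ab.
have [|h [[ph qh] _]] := u _ b l; first by rewrite gl.
by exists h; split=> //; apply: mp; rewrite comp_assoc ph.
Qed.

Lemma pullback_unique P' (p' : hom P' X) (q' : hom P' Y) :
  is_pullback f g p' q' ->
  exists2 k : hom P' P, is_iso k & p ∘ k = p' /\ q ∘ k = q'.
Proof.
move=> pb'; case: (pb) (pb') => fg u [fg' u'].
have [k [[pk qk] _]] := u _ _ _ fg'.
have [l [[pl ql] _]] := u' _ _ _ fg.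
exists k => //; exists l; split.
  have [h [_ hu]] := u' _ _ _ fg'.
  rewrite -(hu (idm _)) ?comp_idr // -(hu (l ∘ k)) //.
  by rewrite !comp_assoc pl ql.
apply: pullback_jointly_monic.
  by rewrite comp_assoc pk comp_idr.
by rewrite comp_assoc qk comp_idr.
Qed.

End Pullback.

Section Pushout.
Variables (Z X Y Q : C) (f : hom Z X) (g : hom Z Y) (c : hom X Q) (v : hom Y Q).
Hypothesis po : is_pushout f g c v.

Lemma pushout_jointly_epic W (a b : hom Q W) :
  a ∘ c = b ∘ c -> a ∘ v = b ∘ v -> a = b.
Proof.
case: po => fg u pab qab.
have [|h [_ hu]] := u W (a ∘ c) (a ∘ v); first by rewrite -!comp_assoc fg.
by rewrite -(hu a) // -(hu b).
Qed.

Lemma pushout_epi : epi g -> epi c.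
Proof.
move=> eg W a b ab; apply: pushout_jointly_epic => //; apply: eg.
by case: po => fg _; rewrite -!comp_assoc -fg !comp_assoc ab.
Qed.

Lemma pushout_unique Q' (c' : hom X Q') (v' : hom Y Q') :
  is_pushout f g c' v' ->
  exists2 k : hom Q Q', is_iso k & k ∘ c = c' /\ k ∘ v = v'.
Proof.
move=> po'; case: (po) (po') => fg u [fg' u'].
have [k [[kc kv] _]] := u _ _ _ fg'.
have [l [[lc lv] _]] := u' _ _ _ fg.
exists k => //; exists l; split.
  apply: pushout_jointly_epic.
    by rewrite -comp_assoc kc comp_idl.
  by rewrite -comp_assoc kv comp_idl.
have [h [_ hu]] := u' _ _ _ fg'.
rewrite -(hu (idm _)) ?comp_idl // -(hu (k ∘ l)) //.
by rewrite -!comp_assoc lc lv.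
Qed.

End Pushout.

Lemma identity_iso X Y (f : hom X Y) : is_identity f -> is_iso f.
Proof. by case=> Z; exact: iso_id. Qed.

Lemma identity_obj X Y (f : hom X Y) : is_identity f -> X = Y.
Proof. by case. Qed.

Lemma identity_eq X (f : hom X X) : is_identity f -> f = idm X.
Proof.
suff H Y (g : hom X Y) : is_identity g ->
    forall e : X = Y,
      g = match e in _ = Z return hom X Z with erefl => idm X end by move=> /H /(_ erefl).
by case=> Z e; rewrite (Prop_irrelevance e erefl).
Qed.

Section Terminal.
Variable one : C.
Hypothesis one_terminal : is_terminal one.

Definition bang X : hom X one := projT1 (cid (one_terminal X)).

Lemma to_one X (f g : hom X one) : f = g.
Proof. by have [q qu] := one_terminal X; rewrite (qu f) (qu g). Qed.

Lemma point_strong Y (j : hom one Y) : strong_mono j.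
Proof.
split=> [W f g _|P Q e a b ee ab]; first exact: to_one.
exists (bang Q); split; first exact: to_one.
by apply: ee; rewrite -ab -comp_assoc; congr (_ ∘ _); exact: to_one.
Qed.

(** The form of [pullback_iso_at] used below: the fibre over [j] is the point [x] alone, tested on
    generalised elements [W]. *)
Definition uniq_lift X Y (d : hom X Y) (j : hom one Y) : Prop :=
  exists2 x : hom one X, d ∘ x = j &
    forall W (a : hom W X), d ∘ a = j ∘ bang W -> a = x ∘ bang W.

Lemma uniq_liftP X Y (d : hom X Y) (j : hom one Y) :
  pullback_iso_at d j <-> uniq_lift d j.
Proof.
split=> [[P [p [q [[dp u] [l [lq ql]]]]]]|[x dx xu]].
  exists (p ∘ l) => [|W a da]; first by rewrite comp_assoc dp -comp_assoc ql comp_idr.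
  have [h [[<- qh] _]] := u _ _ _ da.
  by rewrite -qh -comp_assoc; congr (_ ∘ _); rewrite comp_assoc lq comp_idl.
exists one, x, (idm one); split; last exact: iso_id.
split=> [|W a b dab]; first by rewrite comp_idr.
exists (bang W); split=> [|h _]; last exact: to_one.
split; last exact: to_one.
by apply/esym/xu; rewrite dab; congr (_ ∘ _); exact: to_one.
Qed.

(** The pullback of [d] along [j], with the projection to [one] left out because it carries no
    information. *)
Definition fibre X B (d : hom X B) (j : hom one B) A (u : hom A X) : Prop :=
  [/\ d ∘ u = j ∘ bang A, mono u &
    forall W (a : hom W X), d ∘ a = j ∘ bang W -> exists h, u ∘ h = a].

Lemma fibreP X B (d : hom X B) (j : hom one B) A (u : hom A X) (q : hom A one) :
  fibre d j u <-> is_pullback d j u q.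
Proof.
rewrite (to_one q (bang A)); split=> [[du mu uu]|pb].
  split=> // W a b; rewrite (to_one b (bang W)) => /uu [h uh].
  exists h; split=> [|k [uk _]]; first by split=> //; exact: to_one.
  by apply: mu; rewrite uh uk.
split; first by case: pb.
  by case: (pullback_strong pb (point_strong j)).
by case: pb => _ u' W a /u' [h [[uh _] _]]; exists h.
Qed.

Lemma fibre_strong X B (d : hom X B) (j : hom one B) A (u : hom A X) :
  fibre d j u -> strong_mono u.
Proof.
by move=> /(fibreP _ _ _ (bang A)) /pullback_strong; apply; exact: point_strong.
Qed.

Lemma uniq_lift_fibre X B (d : hom X B) (j : hom one B) A (u : hom A X) :
  fibre d j u -> uniq_lift d j <-> is_iso (bang A).
Proof.
move=> [du mu uu]; split=> [[x dx xu]|[l [lb bl]]].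
  have [|y uy] := uu _ x; first by rewrite dx (to_one (bang one) (idm one)) comp_idr.
  exists y; split; last exact: to_one.
  by apply: mu; rewrite comp_idr comp_assoc uy; apply/esym/xu.
exists (u ∘ l) => [|W a /uu [h <-]].
  by rewrite comp_assoc du -comp_assoc bl comp_idr.
rewrite -comp_assoc; congr (_ ∘ _).
by rewrite -[LHS]comp_idl -lb -comp_assoc; congr (_ ∘ _); exact: to_one.
Qed.

Lemma iso_uniq_lift X Y (f : hom X Y) (j : hom one Y) : is_iso f -> uniq_lift f j.
Proof.
move=> [g [gf fg]]; exists (g ∘ j) => [|W a fa].
  by rewrite comp_assoc fg comp_idl.
by rewrite -comp_assoc -fa comp_assoc gf comp_idl.
Qed.

Lemma uniq_lift_comp X B B' (d : hom X B) (h : hom B B') j :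
  is_iso h -> uniq_lift d j -> uniq_lift (h ∘ d) (h ∘ j).
Proof.
move=> hi [x dx xu]; exists x => [|W a]; first by rewrite -comp_assoc dx.
by rewrite -!comp_assoc => /(iso_mono hi) /xu.
Qed.

Lemma uniq_lift_iso_fibre X B (d : hom X B) (j : hom one B) :
  uniq_lift d j -> exists x : hom one X, fibre d j x.
Proof.
move=> [y dy yu]; exists y; split=> [||W a /yu ->]; last by exists (bang W).
  by rewrite dy (to_one (bang one) (idm one)) comp_idr.
by case: (point_strong y).
Qed.

End Terminal.
End Morphisms.

Lemma existT_eq (T : Type) (P : T -> Type) (x y : T) (a : P x) (b : P y) :
  existT P x a = existT P y b -> exists e : x = y, eq_rect x P a y e = b.
Proof. by move=> h; exists (projT1_eq h); exact: (projT2_eq h). Qed.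

Lemma card_fset_set_lt (T U : choiceType) (S : set T) (S' : set U) (f : U -> T)
    (x : T) :
  finite_set S -> finite_set S' -> set_inj S' f ->
  (forall y, S' y -> S (f y)) -> S x -> (forall y, S' y -> f y <> x) ->
  #|` fset_set S'| < #|` fset_set S|.
Proof.
move=> fS fS' fi fS'S Sx fx.
have -> : #|` fset_set S'| = #|` fset_set (f @` S')%classic|.
  rewrite fset_set_image // card_in_imfset // => y z.
  rewrite !in_fset_set // => yS zS; exact: fi.
have xS : x \in fset_set S by rewrite in_fset_set // inE.
rewrite (cardfsD1 x (fset_set S)) xS add1n ltnS; apply: fsubset_leq_card.
apply/fsubsetP => y; rewrite in_fset_set ?inE => [|]; last exact: finite_image.
case=> z zS' <-; apply/andP; split; first by apply/eqP; exact: fx.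
by rewrite in_fset_set // inE; exact: fS'S.
Qed.

Lemma node_inj (L : Type) (ar : L -> nat) l (U V : 'I_(ar l) -> tree ar) :
  node l U = node l V -> U = V.
Proof.
move=> [h]; have [e] := existT_eq h.
by rewrite (Prop_irrelevance e erefl).
Qed.

Lemma prunes_antisym (L : Type) (ar : L -> nat) (X Y : tree ar) :
  prunes X Y -> prunes Y X -> X = Y.
Proof.
move=> XY; elim: XY => [{}X|l U V _ IH] YX.
  by case: X YX => // l U YX; have [] := prunes_nodeE YX.
have [W VW WU] := prunes_nodeE YX; rewrite -(node_inj VW) in WU.
by congr node; apply/funext => p; exact: IH.
Qed.

Section NineAx.
Variables (C : category) (one : C).
Hypothesis ax : nine_axioms one.
Implicit Types W X Y Z A B : C.

Let one_terminal : is_terminal one := A1 ax.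
Local Notation bang := (bang one_terminal).
Local Notation uniq_lift := (uniq_lift one_terminal).
Local Notation fibre := (fibre one_terminal).
Local Notation to_one := (to_one one_terminal).

(** * Collapses and normal objects *)

Lemma bang_one : bang one = idm one.
Proof. exact: to_one. Qed.

(** All fibres of an isomorphism are trivial, so A9 applies. *)
Lemma iso_identity X Y (f : hom X Y) : is_iso f -> is_identity f.
Proof.
move=> fi; apply: (A9 ax); first exact: iso_epi.
by move=> j; apply/(uniq_liftP one_terminal)/iso_uniq_lift.
Qed.

Lemma iso_obj X Y (f : hom X Y) : is_iso f -> X = Y.
Proof. by move/iso_identity/identity_obj. Qed.

Lemma iso_eq_id X (f : hom X X) : is_iso f -> f = idm X.
Proof. by move/iso_identity/identity_eq. Qed.

Lemma epi_uniq_lift_iso X Y (d : hom X Y) :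
  epi d -> (forall j, uniq_lift d j) -> is_iso d.
Proof.
move=> de du; apply/identity_iso/(A9 ax) => // j.
by apply/(uniq_liftP one_terminal).
Qed.

Lemma epi_from_one Y (j : hom one Y) : epi j -> is_iso j.
Proof. by move=> je; apply: epi_strong_iso => //; exact: point_strong. Qed.

Lemma bang_iso X : is_iso (bang X) <-> X = one.
Proof.
split=> [/iso_obj //|e]; rewrite e; rewrite bang_one; exact: iso_id.
Qed.

(* The maps A -> C in F(A, id_1) are isomorphisms, so A6 provides some
   isomorphism from A followed by an epimorphism to 1. *)
Lemma bang_epi X : epi (bang X).
Proof.
have [[D d u de us pb] _] := A6 ax X (idm one).
have {}pb := pb (bang X); case: (pb) => du _.
have [|h [[uh _] _]] := (pb.2 D (idm D) (bang D)); first exact: to_one.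
have ue : epi u.
  by apply: (@epi_cancel _ _ _ _ _ h); rewrite uh; exact/iso_epi/iso_id.
rewrite (to_one (bang X) (d ∘ u)); exact: epi_comp.
Qed.

(** Well-founded by A7: precomposition with [d] embeds the finitely many epimorphisms out of [Y]
    into those out of [X], and it misses the identity of [X] because a proper epimorphism has no
    left inverse. *)
Lemma epi_ind (P : C -> Prop) :
  (forall X, (forall Y (d : hom X Y), epi d -> ~ is_iso d -> P Y) -> P X) ->
  forall X, P X.
Proof.
move=> IH X.
pose S X : set {classic {B : C & hom X B}} :=
  [set e : {B : C & hom X B} | epi (projT2 e)]%classic.
have fS Y : finite_set (S Y) by case: (A7 ax Y).
have [n] := ubnP #|` fset_set (S X)|.
elim: n X => // n IHn X Xn; apply: IH => Y d de dn.
apply: IHn; rewrite -ltnS; apply: leq_ltn_trans Xn.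
pose f (e : {B : C & hom Y B}) : {B : C & hom X B} :=
  existT _ (projT1 e) (projT2 e ∘ d).
apply: (@card_fset_set_lt _ _ (S X) (S Y) f (existT (hom X) X (idm X)) (fS X) (fS Y)).
- move=> [B e] [B' e'] _ _; rewrite /f /= => /(@existT_eq _ (hom X)) [eB].
  by subst B' => /= /de ->.
- by move=> [B e] /= ee; exact: epi_comp.
- exact/iso_epi/iso_id.
move=> [B e] /= ee; rewrite /f /= => /(@existT_eq _ (hom X)) [eB].
subst B => /= ed; apply: dn.
exact: split_mono_epi_iso ed.
Qed.

(** The dual count, on incoming strong monomorphisms. *)
Lemma strong_ind (P : C -> Prop) :
  (forall X, (forall A (u : hom A X), strong_mono u -> ~ is_iso u -> P A) -> P X) ->
  forall X, P X.
Proof.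
move=> IH X.
pose S X : set {classic {A : C & hom A X}} :=
  [set m : {A : C & hom A X} | strong_mono (projT2 m)]%classic.
have fS Y : finite_set (S Y) by case: (A7 ax Y).
have [n] := ubnP #|` fset_set (S X)|.
elim: n X => // n IHn X Xn; apply: IH => Y u us un.
apply: IHn; rewrite -ltnS; apply: leq_ltn_trans Xn.
pose f (m : {A : C & hom A Y}) : {A : C & hom A X} :=
  existT _ (projT1 m) (u ∘ projT2 m).
apply: (@card_fset_set_lt _ _ (S X) (S Y) f (existT (hom ^~ X) X (idm X)) (fS X) (fS Y)).
- move=> [B e] [B' e'] _ _; rewrite /f /= => /(@existT_eq _ (hom ^~ X)) [eB].
  by subst B' => /= /us.1 ->.
- by move=> [B e] /= ee; exact: strong_comp.
- exact/iso_strong/iso_id.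
move=> [B e] /= ee; rewrite /f /= => /(@existT_eq _ (hom ^~ X)) [eB].
subst B => /= ue; apply: un.
apply: epi_strong_iso => //; apply: (@epi_cancel _ _ _ _ _ e).
by rewrite ue; exact/iso_epi/iso_id.
Qed.

Lemma strong_epi_pullback X Y B P (d : hom X Y) (v : hom B Y) (p : hom P X)
    (q : hom P B) :
  epi d -> strong_mono v -> is_pullback d v p q -> epi q.
Proof.
move=> de vs pb; have [P' [p' [q' [pb' q'e]]]] := A3 ax de vs.
have [k ki [_ qk]] := pullback_unique pb' pb.
by rewrite -qk; apply: epi_comp => //; exact: iso_epi.
Qed.

Lemma fibre_exists X B (d : hom X B) (j : hom one B) :
  epi d -> exists A (u : hom A X), fibre d j u.
Proof.
move=> de.
have [A [u [q [pb _]]]] := A3 ax de (point_strong one_terminal j).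
by exists A, u; apply/fibreP; exact: pb.
Qed.

(* A5 leaves at most one nontrivial fibre of [c]; since the square is also a
   pullback, it lies over [v ∘ t] for the nontrivial point [t] of [k]. *)
Lemma one_point_pushout D X E (u : hom D X) (k : hom D E) :
  strong_mono u -> one_point_epi one k ->
  exists Y (c : hom X Y) (v : hom E Y),
    [/\ epi c, strong_mono v, is_pushout u k c v, is_pullback c v u k &
        forall j, uniq_lift c j \/ exists t, j = v ∘ t].
Proof.
move=> us kop; have ke := kop.1.
have [Y [c [v [po vs pb]]]] := A4 ax us ke.
have cop := A5 ax kop us po.
exists Y, c, v; split=> //; first by case: cop.
move=> j; have [h|h] := pselect (uniq_lift c j); [by left|right].
have [ki|kn] := pselect (is_iso k).
  case: h; apply: iso_uniq_lift.
  case: ki => l [lk kl].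
  have [|h [[hc hv] _]] := po.2 X (idm X) (u ∘ l).
    by rewrite comp_idl -comp_assoc lk comp_idr.
  apply: split_mono_epi_iso hc; exact: pushout_epi po ke.
have [t tn] : exists t, ~ uniq_lift k t.
  by apply/existsNP => kt; apply: kn; exact: epi_uniq_lift_iso.
exists t; apply: cop.2; rewrite (uniq_liftP one_terminal) //.
move=> [x cx xu]; apply: tn.
have [y [[uy ky] _]] := pb.2 _ _ _ cx.
exists y => // W a ka; apply: us.1.
rewrite comp_assoc uy; apply: xu.
by rewrite comp_assoc pb.1 -comp_assoc ka comp_assoc.
Qed.

Lemma bang_one_point A : one_point_epi one (bang A).
Proof.
split; first exact: bang_epi.
by move=> j j' _ _; exact: to_one.
Qed.

(** The quotient X/A. A5 applies because [one] has a single point, and the pullback half of A4 says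
    that the fibre over the collapsed point is again [A]. *)
Lemma collapse A X (u : hom A X) :
  strong_mono u ->
  exists Y (c : hom X Y) (v : hom one Y),
    [/\ epi c, is_pushout u (bang A) c v, fibre c v u & one_point_epi one c].
Proof.
move=> us; have [Y [c [v [po vs pb]]]] := A4 ax us (@bang_epi A).
have cop := A5 ax (bang_one_point A) us po; have [ce _] := cop.
by exists Y, c, v; split=> //; apply/fibreP; exact: pb.
Qed.

Lemma fibre_one X Y (c : hom X Y) (v : hom one Y) A (u : hom A X) :
  fibre c v u -> Y = one -> is_iso u.
Proof.
move=> [cu um uu] Y1; subst Y.
have [|h uh] := uu _ (idm X); first exact: to_one.
by exists h; split=> //; apply: um; rewrite comp_assoc uh comp_idl comp_idr.
Qed.

Lemma fibre_not_iso X Y (c : hom X Y) (v : hom one Y) A (u : hom A X) :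
  fibre c v u -> A <> one -> ~ is_iso c.
Proof.
move=> fu A1 /(@iso_uniq_lift _ _ one_terminal _ _ _ v) h; apply: A1.
by apply/bang_iso/(uniq_lift_fibre fu).
Qed.

Lemma epi_nontrivial_fibre X Y (d : hom X Y) :
  epi d -> ~ is_iso d ->
  exists (j : hom one Y) A (u : hom A X), fibre d j u /\ A <> one.
Proof.
move=> de dn.
have [j jn] : exists j, ~ uniq_lift d j.
  by apply/existsNP => dj; apply: dn; exact: epi_uniq_lift_iso.
have [A [u fu]] := fibre_exists j de.
exists j, A, u; split=> // /bang_iso /(uniq_lift_fibre fu) //.
Qed.

Lemma epi_one X Y (d : hom X Y) : epi d -> X = one -> Y = one.
Proof. by move=> + X1; subst X => /epi_from_one /iso_obj. Qed.

(** [d] is constant on each of its fibres, so it factors through the pushout that collapses a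
    nontrivial one. *)
Lemma epi_factor X N (d : hom X N) :
  epi d -> ~ is_iso d ->
  exists A (u : hom A X) Y (c : hom X Y) (v : hom one Y) (d1 : hom Y N),
    [/\ strong_mono u, A <> one, epi c, is_pushout u (bang A) c v &
      fibre c v u] /\ [/\ ~ is_iso c, epi d1, d1 ∘ c = d & one_point_epi one c].
Proof.
move=> de dn; have [j [A [u [fu A1]]]] := epi_nontrivial_fibre de dn.
have us := fibre_strong fu.
have [Y [c [v [ce po fc cop]]]] := collapse us.
case: fu => du _ _.
have [d1 [[d1c _] _]] := po.2 _ _ _ du.
exists A, u, Y, c, v, d1; split; split=> //.
  exact: fibre_not_iso fc A1.
by apply: (@epi_cancel _ _ _ _ _ c); rewrite d1c.
Qed.

Lemma collapse_comparable X A B (u : hom A X) (w : hom B X) (k : hom A B) YA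
    (cA : hom X YA) (vA : hom one YA) YB (cB : hom X YB) (vB : hom one YB) :
  w ∘ k = u -> is_pushout u (bang A) cA vA -> is_pushout w (bang B) cB vB ->
  exists h : hom YA YB, h ∘ cA = cB.
Proof.
move=> wk poA poB; have [|h [[hc _] _]] := poA.2 _ cB vB; last by exists h.
rewrite -wk comp_assoc poB.1 -comp_assoc; congr (_ ∘ _); exact: to_one.
Qed.

(** The common quotient is obtained by collapsing in [YA] the strong image of [B]. If that quotient
    is [one], then [A] and [B] turn out to be nested, and one of the two collapses factors through
    the other. *)
Lemma collapse_confluent X A B (u : hom A X) (w : hom B X) YA
    (cA : hom X YA) (vA : hom one YA) YB (cB : hom X YB) (vB : hom one YB) :
  strong_mono u -> strong_mono w -> epi cA -> epi cB ->
  is_pushout u (bang A) cA vA -> is_pushout w (bang B) cB vB ->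
  fibre cA vA u -> YA <> one -> YB <> one ->
  exists W (a : hom YA W) (b : hom YB W),
    [/\ W <> one, epi a, epi b & a ∘ cA = b ∘ cB].
Proof.
move=> us ws cAe cBe poA poB fA YA1 YB1.
have [I [e [m [ee ms cw]]]] := A2 ax (cA ∘ w).
have [W [a [z [ae poW fW _]]]] := collapse ms.
have [W1|W1] := pselect (W = one); last first.
  have [|b [[bc _] _]] := poB.2 _ (a ∘ cA) z.
    rewrite -comp_assoc cw comp_assoc poW.1 -comp_assoc.
    by congr (_ ∘ _); exact: to_one.
  exists W, a, b; split=> //; apply: (@epi_cancel _ _ _ _ _ cB).
  by rewrite bc; exact: epi_comp.
(* Now B maps onto YA, hence meets A, and A8 makes A and B comparable. *)
have mi := fibre_one fW W1.
have cwe : epi (cA ∘ w) by rewrite cw; apply: epi_comp => //; exact: iso_epi.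
have [P [p [q [pb qe]]]] := A3 ax cwe (point_strong one_terminal vA).
have ps := pullback_strong pb (point_strong one_terminal vA).
case: (fA) => _ _ /(_ P (w ∘ p)) [|p' up].
  by rewrite comp_assoc pb.1 (to_one q (bang P)).
have p's : strong_mono p'.
  by apply: (@strong_cancel _ _ _ _ u); rewrite up; exact: strong_comp.
case: (A8 ax p's ps us ws up) => [[h [_ wh]]|[h [_ uh]]].
  have [k kc] := collapse_comparable wh poA poB.
  exists YB, k, (idm YB); split=> //; last by rewrite comp_idl.
    by apply: (@epi_cancel _ _ _ _ _ cA); rewrite kc.
  exact/iso_epi/iso_id.
have [k kc] := collapse_comparable uh poB poA.
exists YA, (idm YA), k; split=> //; last by rewrite comp_idl.
  exact/iso_epi/iso_id.
by apply: (@epi_cancel _ _ _ _ _ cB); rewrite kc.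
Qed.

(* Newman's argument: the collapses are locally confluent, and a proper
   epimorphism strictly decreases the number of outgoing epimorphisms. *)
Lemma epi_confluent X N N' (d : hom X N) (d' : hom X N') :
  epi d -> epi d' -> N <> one -> N' <> one ->
  exists W (e : hom N W) (e' : hom N' W),
    [/\ W <> one, epi e, epi e' & e ∘ d = e' ∘ d'].
Proof.
elim/epi_ind: X N N' d d' => X IH N N' d d' de d'e N1 N'1.
have [di|dn] := pselect (is_iso d).
  case: (di) => l [ld dl]; exists N', (d' ∘ l), (idm N'); split=> //.
  - apply: epi_comp => //; apply: iso_epi; by exists d.
  - exact/iso_epi/iso_id.
  by rewrite -comp_assoc ld comp_idl comp_idr.
have [di'|dn'] := pselect (is_iso d').
  case: (di') => l [ld dl]; exists N, (idm N), (d ∘ l); split=> //.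
  - exact/iso_epi/iso_id.
  - apply: epi_comp => //; apply: iso_epi; by exists d'.
  by rewrite -comp_assoc ld comp_idl comp_idr.
have [A [u [Y [c [v [d1 [[us A1 ce po fc] [cn d1e d1c _]]]]]]]] := epi_factor de dn.
have [A' [u' [Y' [c' [v' [d1' [[us' A1' ce' po' fc'] [cn' d1e' d1c' _]]]]]]]] :=
  epi_factor d'e dn'.
have Y1 : Y <> one by move=> h; apply: N1; exact: epi_one d1e h.
have Y1' : Y' <> one by move=> h; apply: N'1; exact: epi_one d1e' h.
have [W0 [a [b [W01 ae be ab]]]] := collapse_confluent us us' ce ce' po po' fc Y1 Y1'.
have [W1 [e1 [f1 [W11 e1e f1e ef1]]]] := IH _ c ce cn _ _ d1 a d1e ae N1 W01.
have [W2 [e2 [f2 [W21 e2e f2e ef2]]]] :=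
  IH _ c' ce' cn' _ _ (f1 ∘ b) d1' (epi_comp be f1e) d1e' W11 N'1.
exists W2, (e2 ∘ e1), f2; split=> //; first exact: epi_comp.
rewrite -d1c -d1c' !comp_assoc -ef2 -(comp_assoc e2 e1) ef1.
by rewrite -!comp_assoc ab.
Qed.

(** Otherwise the collapse of [I] and [d] would have a common quotient other than [one]. Restricted
    to [I], the map to this quotient is an epimorphism, since [d ∘ m] is, and yet factors through a
    point. *)
Lemma strong_onto_quotient_iso I X B (d : hom X B) (m : hom I X) :
  epi d -> B <> one -> strong_mono m -> epi (d ∘ m) -> is_iso m.
Proof.
move=> de B1 ms dme; have [Y [c [v [ce po fc _]]]] := collapse ms.
have [Y1|Y1] := pselect (Y = one); first exact: fibre_one fc Y1.
have [W [e [e' [W1 ee ee' ec]]]] := epi_confluent de ce B1 Y1.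
case: W1; have h : epi (e' ∘ v ∘ bang I).
  rewrite -comp_assoc -po.1 comp_assoc -ec -comp_assoc; exact: epi_comp.
by apply: (@epi_one _ _ (e' ∘ v)) => //; exact: epi_cancel h.
Qed.

(** * Normal objects and normal quotients *)

Lemma normal_epi_iso X N (d : hom N X) :
  normal one N -> epi d -> X <> one -> is_iso d.
Proof. by move=> nN de X1; apply/identity_iso/nN; left. Qed.

(** Normality leaves two possibilities for the collapse of [A]: its target is [one], and [A] is
    everything, or it is an isomorphism, and [A] was already a point. *)
Lemma normal_strong N A (m : hom A N) :
  normal one N -> strong_mono m -> is_iso m \/ A = one.
Proof.
move=> nN ms; have [Y [c [v [ce po fc _]]]] := collapse ms.
have [Y1|Y1] := pselect (Y = one); first by left; exact: fibre_one fc Y1.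
right; apply: contrapT => A1.
by apply: (fibre_not_iso fc A1); exact: normal_epi_iso.
Qed.

Lemma normal_exists X : X <> one ->
  exists N (d : hom X N), [/\ epi d, N <> one & normal one N].
Proof.
elim/epi_ind: X => X IH X1.
have [nX|/existsNP [Y /existsNP [d /not_implyP [[[de Y1]|[_ di //]] dn]]]] :=
  pselect (normal one X).
  by exists X, (idm X); split=> //; exact/iso_epi/iso_id.
have [|N [e [ee N1 nN]]] := IH _ d de _ Y1; first by move/iso_identity.
by exists N, (e ∘ d); split=> //; exact: epi_comp.
Qed.

Lemma normal_quotient_unique X N N' (d : hom X N) (d' : hom X N') :
  epi d -> epi d' -> N <> one -> N' <> one -> normal one N -> normal one N' ->
  exists2 h : hom N N', is_iso h & h ∘ d = d'.
Proof.
move=> de d'e N1 N'1 nN nN'.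
have [W [e [e' [W1 ee ee' ed]]]] := epi_confluent de d'e N1 N'1.
have ei := normal_epi_iso nN ee W1.
have [l li [le el]] := iso_sym (normal_epi_iso nN' ee' W1).
exists (l ∘ e); first exact: iso_comp.
by rewrite -comp_assoc ed comp_assoc le comp_idl.
Qed.

Lemma normal_quotient_eq X N (d d' : hom X N) :
  epi d -> epi d' -> N <> one -> normal one N -> d = d'.
Proof.
move=> de d'e N1 nN; have [h hi <-] := normal_quotient_unique de d'e N1 N1 nN nN.
by rewrite (iso_eq_id hi) comp_idl.
Qed.

(* An epimorphism is the joint pushout of the collapses of its fibres. *)
Lemma epi_universal X T (d : hom X T) Z (f : hom X Z) :
  epi d ->
  (forall j A (u : hom A X), fibre d j u -> exists z, f ∘ u = z ∘ bang A) ->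
  exists g, f = g ∘ d.
Proof.
elim/epi_ind: X T d Z f => X IH T d Z f de fz.
have [di|dn] := pselect (is_iso d).
  by case: di => l [ld dl]; exists (f ∘ l); rewrite -comp_assoc ld comp_idr.
have [j [A [u [fu A1]]]] := epi_nontrivial_fibre de dn.
have us := fibre_strong fu.
have [Y [c [v [ce po fc _]]]] := collapse us.
have [z fuz] := fz _ _ _ fu; have [f1 [[f1c _] _]] := po.2 _ _ _ fuz.
case: (fu) => du _ _; have [d1 [[d1c _] _]] := po.2 _ _ _ du.
have d1e : epi d1 by apply: (@epi_cancel _ _ _ _ _ c); rewrite d1c.
have [|g gE] := IH _ c ce (fibre_not_iso fc A1) _ d1 _ f1 d1e; last first.
  by exists g; rewrite -d1c comp_assoc -gE f1c.
move=> j' P p fp; have ps := fibre_strong fp.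
(* A fibre of [d1] pulls back along [c] to a fibre of [d], on which [f] is constant; constancy
   descends along the epimorphism [q]. *)
have [A' [u' [q [pb qe]]]] := A3 ax ce ps.
have fu' : fibre d j' u'.
  case: fp => dp pm pu; split.
  - rewrite -d1c -comp_assoc pb.1 comp_assoc dp -comp_assoc.
    by congr (_ ∘ _); exact: to_one.
  - by case: (pullback_strong pb ps).
  move=> W a; rewrite -d1c -comp_assoc => /pu [h ph].
  by have [k [[uk _] _]] := pb.2 _ _ _ (esym ph); exists k.
have [z' z'E] := fz _ _ _ fu'; exists z'; apply: qe.
rewrite -comp_assoc -pb.1 comp_assoc f1c z'E -comp_assoc.
by congr (_ ∘ _); exact: to_one.
Qed.

(** Each map is constant on the fibres of the other, so each factors through the other; the
    comparison is an automorphism of [T], hence the identity. *)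
Lemma epi_eq X T (d d' : hom X T) :
  epi d -> epi d' ->
  (forall j A (u : hom A X), fibre d j u -> d' ∘ u = j ∘ bang A) ->
  (forall j A (u : hom A X), fibre d' j u -> d ∘ u = j ∘ bang A) -> d = d'.
Proof.
move=> de d'e h h'.
have [|g gE] := epi_universal (f := d') de.
  by move=> j A u /h uE; exists j.
have [|g' g'E] := epi_universal (f := d) d'e.
  by move=> j A u /h' uE; exists j.
have ge : epi g by apply: (@epi_cancel _ _ _ _ _ d); rewrite -gE.
rewrite gE (_ : g = idm T) ?comp_idl //; apply: iso_eq_id.
apply: (@split_mono_epi_iso _ _ _ _ g') => //.
by apply: de; rewrite -comp_assoc -gE -g'E comp_idl.
Qed.

(** The base change of [c] along [p] is an epimorphism with trivial fibres only, hence invertible;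
    its inverse gives the section. *)
Lemma uniq_lift_section X Y P (c : hom X Y) (p : hom P Y) :
  epi c -> strong_mono p -> (forall t, uniq_lift c (p ∘ t)) ->
  exists2 s : hom P X, c ∘ s = p &
    forall W (a : hom W X) (b : hom W P), c ∘ a = p ∘ b -> a = s ∘ b.
Proof.
move=> ce ps ct; have [Q [x [y [pb ye]]]] := A3 ax ce ps.
have [|l [ly yl]] := epi_uniq_lift_iso ye.
  move=> t; have [z cz zu] := ct t.
  have [w [[xw yw] _]] := pb.2 _ _ _ cz.
  exists w => // W a ya; apply: (pullback_jointly_monic pb).
    rewrite comp_assoc xw; apply: zu.
    by rewrite comp_assoc pb.1 -!comp_assoc ya.
  by rewrite comp_assoc yw ya.
exists (x ∘ l); first by rewrite comp_assoc pb.1 -comp_assoc yl comp_idr.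
move=> W a b /pb.2 [h [[<- <-] _]].
by rewrite -!comp_assoc (comp_assoc l) ly comp_idl.
Qed.

Lemma fibre_iso X B (d : hom X B) j A (u : hom A X) A' (k : hom A' A) :
  fibre d j u -> is_iso k -> fibre d j (u ∘ k).
Proof.
move=> [du um uu] ki; case: (ki) => l [lk kl]; split.
- by rewrite comp_assoc du -comp_assoc; congr (_ ∘ _); exact: to_one.
- by move=> W a b; rewrite -!comp_assoc => /um /(iso_mono ki).
move=> W a /uu [h <-]; exists (l ∘ h).
by rewrite -comp_assoc (comp_assoc k) kl comp_idl.
Qed.

(** * Replacing one fibre by a quotient of it *)

Section PushFibre.
Variables (X B D E Y : C) (d : hom X B) (j : hom one B) (u : hom D X)
  (k : hom D E) (c : hom X Y) (v : hom E Y) (d1 : hom Y B).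
Hypotheses (de : epi d) (fu : fibre d j u) (ke : epi k) (ce : epi c)
  (vs : strong_mono v) (pb : is_pullback c v u k)
  (cj : forall j, uniq_lift c j \/ exists t, j = v ∘ t) (d1c : d1 ∘ c = d).

Lemma push_fibre_over : d1 ∘ v = j ∘ bang E.
Proof.
apply: ke; rewrite -comp_assoc -pb.1 comp_assoc d1c; case: fu => -> _ _.
by rewrite -comp_assoc; congr (_ ∘ _); exact: to_one.
Qed.

Lemma push_fibre_epi : epi d1.
Proof. by apply: (@epi_cancel _ _ _ _ _ c); rewrite d1c. Qed.

(** Compare [v] with the actual fibre [p] over [j] through [t]. It is strong because [p ∘ t] is [v],
    and it is epi because [t ∘ k] is a base change of the epimorphism [c]. *)
Lemma push_fibre_here : fibre d1 j v.
Proof.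
have [P [p fp]] := fibre_exists j push_fibre_epi.
have ps := fibre_strong fp; case: (fp) => dp pm pu.
have [t pt] := pu _ _ push_fibre_over.
rewrite -pt; apply: fibre_iso => //; apply: epi_strong_iso; last first.
  by apply: (@strong_cancel _ _ _ _ p); rewrite pt.
case: (fu) => du _ uu.
have [|κ pκ] := pu _ (c ∘ u); first by rewrite comp_assoc d1c.
have tk : t ∘ k = κ by apply: pm; rewrite comp_assoc pt pκ pb.1.
apply: (@epi_cancel _ _ _ _ _ k); rewrite tk.
apply: (strong_epi_pullback ce ps (p := u)); split; first by rewrite pκ.
move=> W a b cab; have [|h uh] := uu _ a.
  rewrite -d1c -comp_assoc cab comp_assoc dp -comp_assoc.
  by congr (_ ∘ _); exact: to_one.
exists h; split=> [|h' [uh' _]].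
  by split=> //; apply: pm; rewrite comp_assoc pκ -comp_assoc uh.
by case: fu => _ um _; apply: um; rewrite uh uh'.
Qed.

(** No point [v ∘ t] lies over [j'], because [v] lies over [j]. So [c] has trivial fibres over the
    whole fibre [p], and the section [s] of [c] there inverts the comparison map. *)
Lemma push_fibre_other j' A (w : hom A X) :
  j' <> j -> fibre d j' w -> fibre d1 j' (c ∘ w).
Proof.
move=> jj fw; have [P [p fp]] := fibre_exists j' push_fibre_epi.
have ps := fibre_strong fp; case: (fp) => dp pm pu.
have [|s cs su] := uniq_lift_section ce ps.
  move=> t; case: (cj (p ∘ t)) => // -[z pz]; case: jj.
  have := congr1 (fun h => d1 ∘ h) pz; rewrite !comp_assoc dp push_fibre_over.
  rewrite -!comp_assoc (to_one (bang P ∘ t) (idm one)).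
  by rewrite (to_one (bang E ∘ z) (idm one)) !comp_idr.
case: (fw) => dw wm wu.
have [|h wh] := wu _ s; first by rewrite -d1c -comp_assoc cs dp.
have [|k' pk] := pu _ (c ∘ w); first by rewrite comp_assoc d1c.
have sk := su _ _ _ (esym pk).
rewrite -pk; apply: fibre_iso => //; exists h; split.
  by apply: wm; rewrite comp_assoc wh -sk comp_idr.
by apply: pm; rewrite comp_assoc pk -comp_assoc wh cs comp_idr.
Qed.

End PushFibre.

(** * Objects determined by their fibres *)

(* X is the terminal object of F(A, j): if it had a nontrivial fibre over another
   point, collapsing that fibre would give an object of F(A, j) mapping back to X,
   and by terminality the collapse would be a split monomorphism. *)
Lemma filling B (j : hom one B) A :
  exists X (d : hom X B) (u : hom A X),
    [/\ epi d, fibre d j u, forall j', j' <> j -> uniq_lift d j' &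
        B <> one -> forall X' (d' : hom X' B) (u' : hom A X'),
          epi d' -> fibre d' j u' -> (forall j', j' <> j -> uniq_lift d' j') ->
          exists2 h : hom X' X, is_iso h & d ∘ h = d'].
Proof.
have [T Tt] := A6 ax A j.
have fT : fibre (fill_d T) j (fill_u T) by apply/fibreP; exact: (fill_pb T (bang A)).
case: (fT) => _ _ uT; have dT := @fill_epi _ _ _ _ _ T.
have lT j' : j' <> j -> uniq_lift (fill_d T) j'.
  move=> jj; have [D [w fw]] := fibre_exists j' dT.
  case: (fw) => dw _ _.
  apply/(uniq_lift_fibre fw)/bang_iso; apply: contrapT => D1.
  have [Y [c [v [ce vs po pb cj]]]] :=
    one_point_pushout (fibre_strong fw) (bang_one_point D).
  have [d1 [[d1c _] _]] := po.2 _ _ _ dw.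
  have fcu := push_fibre_other dT fw (@bang_epi D) ce pb cj d1c (nesym jj) fT.
  pose S : fill_cat A j := FillObj (push_fibre_epi dT d1c) (fibre_strong fcu)
    (fun q => (fibreP one_terminal d1 j (c ∘ fill_u T) q).1 fcu).
  have cP : c ∘ fill_u T = fill_u S /\ fill_d S ∘ c = fill_d T by [].
  pose cc : hom T S := exist _ c cP.
  have [h _] := Tt S; have [i iu] := Tt T.
  have /(congr1 sval) /= hc : h ∘ cc = idm T by rewrite (iu (h ∘ cc)) (iu (idm T)).
  have fc : fibre c v w by apply/fibreP; exact: pb.
  exact: (fibre_not_iso fc D1 (split_mono_epi_iso ce hc)).
exists (fill_dom T), (fill_d T), (fill_u T); split=> // B1 X' d' u' d'e fu' lu'.
(* Terminality supplies [h] over [B]. Its strong image still maps onto [B], so [h] is epi. Its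
   fibres are trivial: over points above [j] because [h] matches the two copies of [A], elsewhere
   because both projections to [B] have a single point there. *)
pose S : fill_cat A j := FillObj d'e (fibre_strong fu')
    (fun q => (fibreP one_terminal d' j u' q).1 fu').
have [[h [hu dh]] _] := Tt S; rewrite /= in h hu dh.
have he : epi h.
  have [I [e [m [ee ms hE]]]] := A2 ax h.
  rewrite hE; apply: epi_comp => //; apply/iso_epi.
  apply: (strong_onto_quotient_iso dT B1 ms).
  by apply: (@epi_cancel _ _ _ _ _ e); rewrite -comp_assoc -hE dh.
exists h => //; apply: epi_uniq_lift_iso => // p.
have [pj|pj] := pselect (fill_d T ∘ p = j).
  have [|p' up'] := uT _ p; first by rewrite bang_one comp_idr.
  exists (u' ∘ p') => [|W a hap]; first by rewrite comp_assoc hu.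
  case: (fT) => _ um _; case: (fu') => _ _ u'u.
  have [|h' ah] := u'u _ a; first by rewrite -dh -comp_assoc hap comp_assoc pj.
  rewrite -ah -comp_assoc; congr (_ ∘ _); apply: um.
  by rewrite -hu -comp_assoc ah hap -up' hu comp_assoc.
have [x d'x xu] := lu' _ pj; have [y dy yu] := lT _ pj.
exists x => [|W a hap].
  rewrite (yu _ p) ?bang_one ?comp_idr //; apply/esym.
  by rewrite (yu _ (h ∘ x)) bang_one comp_idr // comp_assoc dh.
by apply: xu; rewrite -dh -comp_assoc hap comp_assoc.
Qed.

Lemma fibre_comp X B B' (d : hom X B) (h : hom B B') j A (u : hom A X) :
  is_iso h -> fibre d j u -> fibre (h ∘ d) (h ∘ j) u.
Proof.
move=> hi [du um uu]; split=> // [|W a]; first by rewrite -!comp_assoc du.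
by rewrite -!comp_assoc => /(iso_mono hi) /uu.
Qed.

(** Collapse a common nontrivial fibre [A] in both objects; the quotients agree by induction. Both
    objects then fill [A] in at the same collapsed point, and the uniqueness clause of [filling]
    identifies them. *)
Lemma rigidity X X' B (d : hom X B) (d' : hom X' B) :
  epi d -> epi d' -> B <> one ->
  (forall j, exists A (u : hom A X) (u' : hom A X'), fibre d j u /\ fibre d' j u') ->
  exists2 h : hom X X', is_iso h & d' ∘ h = d.
Proof.
elim/epi_ind: X X' B d d' => X IH X' B d d' de d'e B1 dd.
have [di|dn] := pselect (is_iso d).
  have d'i : is_iso d'.
    apply: epi_uniq_lift_iso => // j; have [A [u [u' [fu fu']]]] := dd j.
    by apply/(uniq_lift_fibre fu')/(uniq_lift_fibre fu)/iso_uniq_lift.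
  have [l li [ld dl]] := iso_sym d'i; exists (l ∘ d); first exact: iso_comp.
  by rewrite comp_assoc dl comp_idl.
have [j [A [u [fu A1]]]] := epi_nontrivial_fibre de dn.
have [u' fu'] : exists u' : hom A X', fibre d' j u'.
  have [D [w [w' [fw fw']]]] := dd j.
  have [k ki [wk _]] := pullback_unique
    ((fibreP _ _ _ _ (bang D)).1 fw) ((fibreP _ _ _ _ (bang A)).1 fu).
  by exists (w' ∘ k); apply: fibre_iso.
have [Y [c [v [ce vs po pb cj]]]] :=
  one_point_pushout (fibre_strong fu) (bang_one_point A).
have [Y' [c' [v' [ce' vs' po' pb' cj']]]] :=
  one_point_pushout (fibre_strong fu') (bang_one_point A).
case: (fu) (fu') => du _ _ [du' _ _].
have [d1 [[d1c _] _]] := po.2 _ _ _ du.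
have [d1' [[d1c' _] _]] := po'.2 _ _ _ du'.
have d1e := push_fibre_epi de d1c; have d1e' := push_fibre_epi d'e d1c'.
have fv := push_fibre_here de fu (@bang_epi A) ce vs pb d1c.
have fv' := push_fibre_here d'e fu' (@bang_epi A) ce' vs' pb' d1c'.
have cn : ~ is_iso c.
  by apply: (@fibre_not_iso _ _ c v _ u) => //; apply/fibreP; exact: pb.
have [|h hi dh] := IH _ c ce cn Y' B d1 d1' d1e d1e' B1.
  move=> i; have [->|ij] := pselect (i = j); first by exists one, v, v'.
  have [D [w [w' [fw fw']]]] := dd i; exists D, (c ∘ w), (c' ∘ w'); split.
    exact: (push_fibre_other de fu (@bang_epi A) ce pb cj d1c ij fw).
  exact: (push_fibre_other d'e fu' (@bang_epi A) ce' pb' cj' d1c' ij fw').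
have hv : h ∘ v = v'.
  case: fv fv' => d1v _ _ [d1v' v'm v'u].
  have [|y vy] := v'u _ (h ∘ v); first by rewrite comp_assoc dh.
  by rewrite -vy (to_one y (idm one)) comp_idr.
have Y1' : Y' <> one by move=> h1; apply: B1; exact: epi_one d1e' h1.
have [T [e [w [ee fw ew /(_ Y1') eu]]]] := filling v' A.
have lc i : i <> v' -> uniq_lift c' i.
  by case: (cj' i) => // -[t ->]; rewrite (to_one t (idm one)) comp_idr.
have lhc i : i <> v' -> uniq_lift (h ∘ c) i.
  move=> iv; have [l _ [lh hl]] := iso_sym hi.
  rewrite -[i]comp_idl -hl -comp_assoc; apply: uniq_lift_comp => //.
  case: (cj (l ∘ i)) => // -[t lit]; case: iv.
  by rewrite -[i]comp_idl -hl -comp_assoc lit (to_one t (idm one)) comp_idr.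
have [|k ki ek] := eu _ (h ∘ c) u (epi_comp ce (iso_epi hi)) _ lhc.
  by rewrite -hv; apply: fibre_comp => //; apply/fibreP; exact: pb.
have [|k' ki' ek'] := eu _ c' u' ce' _ lc; first by apply/fibreP; exact: pb'.
have [l li [lk kl]] := iso_sym ki'.
exists (l ∘ k); first exact: iso_comp.
by rewrite -d1c' -ek' -!comp_assoc (comp_assoc k') kl comp_idl ek comp_assoc dh d1c.
Qed.

(** Fill [A] in at the single point [y] of [Y] over [j]. The filling is trivial away from [y], so
    the other fibres lift to it. *)
Lemma fill_point Y B (d : hom Y B) j A :
  epi d -> uniq_lift d j ->
  exists X (d' : hom X B),
    [/\ epi d', exists u : hom A X, fibre d' j u &
      forall i D (w : hom D Y), i <> j -> fibre d i w ->
        exists w' : hom D X, fibre d' i w'].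
Proof.
move=> de [y dy yu]; have [X [e [u [ee [eu um uu] el _]]]] := filling y A.
exists X, (d ∘ e); split; first exact: epi_comp.
  exists u; split=> // [|W a]; first by rewrite -comp_assoc eu comp_assoc dy.
  by rewrite -comp_assoc => /yu /uu.
move=> i D w ij [dw wm wu].
have fw : fibre d i w by [].
have [|s es su] := uniq_lift_section ee (fibre_strong fw).
  move=> t; apply: el => wt; apply: ij.
  rewrite -dy -wt comp_assoc dw -comp_assoc (to_one (bang D ∘ t) (idm one)).
  by rewrite comp_idr.
exists s; split; first by rewrite -comp_assoc es.
  by apply: (@mono_cancel _ _ _ _ e); rewrite es.
move=> W a; rewrite -comp_assoc => /wu [h wh]; exists h.
exact/esym/su.
Qed.

(** [push_fibre_other] needs the pushout to affect only one fibre, which A5 ensures for one-point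
    epimorphisms; hence [a] is decomposed into collapses and pushed one factor at a time. *)
Lemma push_point X B (d : hom X B) j D (u : hom D X) E (a : hom D E) :
  epi d -> fibre d j u -> epi a ->
  exists Y (c : hom X Y) (d' : hom Y B),
    [/\ epi c, epi d', exists v : hom E Y, fibre d' j v &
      forall i A (w : hom A X), i <> j -> fibre d i w ->
        exists w' : hom A Y, fibre d' i w'].
Proof.
elim/epi_ind: D X d u a => D IH X d u a de fu ae.
have [ai|an] := pselect (is_iso a).
  have [l li [la al]] := iso_sym ai.
  exists X, (idm X), d; split=> //; first exact/iso_epi/iso_id.
    by exists (u ∘ l); exact: fibre_iso.
  by move=> i A w _ fw; exists w.
have [A [w [D1 [k [v [a1 [[ws A1 ke po fk] [kn a1e a1k kop]]]]]]]] := epi_factor ae an.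
have [Y [c [v' [ce vs po' pb cj]]]] := one_point_pushout (fibre_strong fu) kop.
have [|d1 [[d1c _] _]] := po'.2 _ d (j ∘ bang D1).
  by case: fu => -> _ _; rewrite -comp_assoc; congr (_ ∘ _); exact: to_one.
have fv := push_fibre_here de fu ke ce vs pb d1c.
have [Z [c' [d' [c'e d'e Ez Az]]]] :=
  IH _ k ke kn Y d1 v' a1 (push_fibre_epi de d1c) fv a1e.
exists Z, (c' ∘ c), d'; split=> //; first exact: epi_comp.
move=> i A' w' ij fw; apply: (Az i A' (c ∘ w') ij).
exact: (push_fibre_other de fu ke ce pb cj d1c ij fw).
Qed.

(** * Prescribing all fibres at once *)

Section Points.
Variables (B : C) (n : nat) (pt : 'I_n -> hom one B).
Hypotheses (pt_inj : injective pt) (pt_surj : forall j, exists k, pt k = j).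

Lemma fill_points (A : 'I_n -> C) :
  exists X (d : hom X B),
    epi d /\ forall k, exists u : hom (A k) X, fibre d (pt k) u.
Proof.
(* Start from the identity of [B], all of whose fibres are [one]. Points outside [s] keep the fibre
   [one], as [fill_point] requires. *)
suff H (s : seq 'I_n) : uniq s -> exists X (d : hom X B), epi d /\
    forall k, exists u : hom (if k \in s then A k else one) X, fibre d (pt k) u.
  have [X [d [de h]]] := H _ (enum_uniq 'I_n); exists X, d; split=> // k.
  by have := h k; rewrite mem_enum.
elim: s => [_|i s IH /= /andP[ins us]].
  exists B, (idm B); have Bi := iso_id B; split; first exact: iso_epi.
  by move=> k; apply: uniq_lift_iso_fibre; exact: iso_uniq_lift.
have [Y [d [de h]]] := IH us.
have [|X [d' [d'e hi hk]]] := @fill_point _ _ _ (pt i) (A i) de.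
  have := h i; rewrite (negbTE ins) => -[u fu].
  by apply/(uniq_lift_fibre fu)/bang_iso.
exists X, d'; split=> // k; rewrite inE; case: eqP => [->//|/= ki].
have [u fu] := h k; apply: (hk (pt k) _ u) => //.
by move/pt_inj.
Qed.

(** Pushing [X] along the given epimorphisms, fibre by fibre, yields a quotient with the fibres of
    [T]; by [rigidity] it is [T]. *)
Lemma epi_of_fibres X T (d : hom X B) (t : hom T B) (D E : 'I_n -> C) :
  epi d -> epi t -> B <> one ->
  (forall k, exists u : hom (D k) X, fibre d (pt k) u) ->
  (forall k, exists v : hom (E k) T, fibre t (pt k) v) ->
  (forall k, exists a : hom (D k) (E k), epi a) ->
  exists c : hom X T, epi c.
Proof.
move=> de te B1 du tv DE.
suff [Y [c [d' [ce d'e h]]]] : exists Y (c : hom X Y) (d' : hom Y B),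
    [/\ epi c, epi d' & forall k, exists u : hom (E k) Y, fibre d' (pt k) u].
  have [j|f fi _] := rigidity d'e te B1; last first.
    by exists (f ∘ c); apply: epi_comp => //; exact: iso_epi.
  have [k <-] := pt_surj j; have [u fu] := h k; have [v fv] := tv k.
  by exists (E k), u, v.
suff H (s : seq 'I_n) : uniq s -> exists Y (c : hom X Y) (d' : hom Y B),
    [/\ epi c, epi d' & forall k,
      exists u : hom (if k \in s then E k else D k) Y, fibre d' (pt k) u].
  have [Y [c [d' [ce d'e h]]]] := H _ (enum_uniq 'I_n).
  by exists Y, c, d'; split=> // k; have := h k; rewrite mem_enum.
elim: s => [_|i s IH /= /andP[ins us]].
  by exists X, (idm X), d; split=> //; exact/iso_epi/iso_id.
have [Y [c [d' [ce d'e h]]]] := IH us.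
have [u fu] : exists u : hom (D i) Y, fibre d' (pt i) u.
  by have := h i; rewrite (negbTE ins).
have [a ae] := DE i.
have [Z [c' [d2 [c'e d2e hi hk]]]] := push_point d'e fu ae.
exists Z, (c' ∘ c), d2; split=> // [|k]; first exact: epi_comp.
rewrite inE; case: eqP => [->//|/= ki].
by have [w fw] := h k; apply: (hk (pt k) _ w) => // /pt_inj.
Qed.

End Points.

(** Thus the input places of a root label are exactly its points. *)
Lemma Comp_normal N A (i : hom A N) :
  normal one N -> N <> one -> indecomposable i <-> A = one.
Proof.
move=> nN N1; split=> [[is_ ini _]|A1].
  by case: (normal_strong nN is_) => // /iso_identity.
subst A; split; first exact: point_strong.
  by move=> /identity_obj /esym.
move=> Z u v us vs iE.
case: (normal_strong nN vs) => [/iso_identity|Z1]; first by right.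
left; subst Z; rewrite (to_one u (idm one)); exact: Is_identity.
Qed.

Lemma Phi_neq_one (phi : Phi one) : sval phi <> one.
Proof. by case: phi => phi []. Qed.

Lemma rhoP X : X <> one -> Ecirc one (projT2 (rho one X)) /\ normal one (r one X).
Proof.
move=> X1; rewrite /r /rho; set D := [set d | _]%classic; set x0 := existT _ _ _.
have [|h1 h2] := @xgetPex {classic {N : C & hom X N}} x0 D; last by [].
by have [N [d [de N1 nN]]] := normal_exists X1; exists (existT _ N d); split=> //; left.
Qed.

Lemma Phi_normal (phi : Phi one) : normal one (sval phi).
Proof.
by case: phi => phi [p1 pr] /=; rewrite -[phi in normal _ phi]pr; case: (rhoP p1).
Qed.

Lemma normal_Phi N : N <> one -> normal one N -> exists phi : Phi one, sval phi = N.
Proof.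
move=> N1 nN; suff rN : r one N = N by exists (exist _ N (conj N1 rN)).
by have [/nN /identity_obj /esym] := rhoP N1.
Qed.

(** The bijection between input places and numbers: place [k] is the [k]-th member of the finite set
    whose cardinality defines the arity. *)
Lemma Phi_points (phi : Phi one) :
  exists pt : 'I_(Phi_ar phi) -> hom one (sval phi),
    injective pt /\ forall j, exists k, pt k = j.
Proof.
have pn := @Phi_normal phi; have p1 := @Phi_neq_one phi.
pose S : set {classic {A : C & hom A (sval phi)}} := Comp (sval phi).
have fS : finite_set S.
  by apply: sub_finite_set (A7 ax (sval phi)).1 => -[A i] [].
have inS (x : {classic {A : C & hom A (sval phi)}}) :
    x \in fset_set S <-> exists j : hom one (sval phi), x = existT (hom ^~ _) one j.
  rewrite in_fset_set // inE; split.
    by case: x => A i /(Comp_normal _ pn p1) /= A1; subst A; exists i.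
  by case=> j ->; apply/Comp_normal.
pose x0 : {classic {A : C & hom A (sval phi)}} := existT (hom ^~ _) _ (idm (sval phi)).
have [k|pt ptE] := @choice 'I_(Phi_ar phi) (hom one (sval phi)) (fun k j =>
    nth x0 (fset_set S) k =
      existT (hom ^~ _) one j).
  by apply/inS/mem_nth.
exists pt; split=> [k k' kk'|j].
  apply/val_inj/eqP.
  rewrite -(nth_uniq x0 (ltn_ord k) (ltn_ord k') (fset_uniq (fset_set S))).
  by apply/eqP; rewrite !ptE kk'.
have jS := (inS _).2 (ex_intro _ j erefl).
have jlt : index (existT (hom ^~ _) one j : {classic _}) (fset_set S) < Phi_ar phi.
  by rewrite index_mem.
exists (Ordinal jlt); have := ptE (Ordinal jlt); rewrite /= nth_index //.
move=> /(@existT_eq _ (hom ^~ _)) [e].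
by rewrite (Prop_irrelevance e erefl).
Qed.

(** The fibre of the composite is the base change of [d] along [v], so its projection to [E] is epi
    by A3. *)
Lemma fibre_restrict X Y B (d : hom X Y) (t : hom Y B) j D (w : hom D X) E
    (v : hom E Y) :
  epi d -> fibre (t ∘ d) j w -> fibre t j v ->
  exists2 e : hom D E, epi e & d ∘ w = v ∘ e.
Proof.
move=> de [dw wm wu] fv; case: (fv) => tv vm vu.
have [|e ve] := vu _ (d ∘ w); first by rewrite comp_assoc.
exists e => //; apply: (strong_epi_pullback de (fibre_strong fv) (p := w)).
split=> // W a b dab; have [|h wh] := wu _ a.
  rewrite -comp_assoc dab comp_assoc tv -comp_assoc.
  by congr (_ ∘ _); exact: to_one.
exists h; split=> [|h' [wh' _]]; last by apply: wm; rewrite wh wh'.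
by split=> //; apply: vm; rewrite comp_assoc ve -comp_assoc wh.
Qed.

(** * Objects as trees, morphisms as addresses *)

Definition point (phi : Phi one) : 'I_(Phi_ar phi) -> hom one (sval phi) :=
  projT1 (cid (Phi_points phi)).

Lemma point_inj phi : injective (@point phi).
Proof. exact: (projT2 (cid (Phi_points phi))).1. Qed.

Lemma point_surj phi j : exists k, @point phi k = j.
Proof. exact: (projT2 (cid (Phi_points phi))).2. Qed.

Section Grow.
Variables (phi : Phi one) (A : 'I_(Phi_ar phi) -> C).

(** The node labelled [phi] with branches [A]. By [rigidity] the choice is immaterial. *)
Definition grow : C := projT1 (cid (fill_points (@point_inj phi) A)).

Definition root : hom grow (sval phi) :=
  projT1 (cid (projT2 (cid (fill_points (@point_inj phi) A)))).

Lemma root_epi : epi root.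
Proof. exact: (projT2 (cid (projT2 (cid (fill_points (@point_inj phi) A))))).1. Qed.

Lemma branch_exists k : exists u : hom (A k) grow, fibre root (point k) u.
Proof. exact: (projT2 (cid (projT2 (cid (fill_points (@point_inj phi) A))))).2. Qed.

Definition branch k : hom (A k) grow := projT1 (cid (branch_exists k)).

Lemma branch_fibre k : fibre root (point k) (branch k).
Proof. exact: projT2 (cid (branch_exists k)). Qed.

Lemma root_branch k : root ∘ branch k = point k ∘ bang (A k).
Proof. by case: (branch_fibre k). Qed.

Lemma branch_mono k : mono (branch k).
Proof. by case: (branch_fibre k). Qed.

Lemma grow_neq_one : grow <> one.
Proof. by move=> g1; apply: (@Phi_neq_one phi); exact: epi_one root_epi g1. Qed.

Lemma root_branch_comp W k (g : hom W (A k)) :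
  root ∘ (branch k ∘ g) = point k ∘ bang W.
Proof.
rewrite comp_assoc root_branch -comp_assoc; congr (_ ∘ _); exact: to_one.
Qed.

(** The strong image of [root ∘ f] in the normal object [phi] is everything or a point. In the first
    case the strong image of [f] maps onto [phi], hence is all of [grow]; in the second [f] lands in
    one fibre. *)
Lemma branch_or_epi W (f : hom W grow) :
  epi f \/ exists k (g : hom W (A k)), f = branch k ∘ g.
Proof.
have [I [e [m [ee ms fE]]]] := A2 ax (root ∘ f).
case: (normal_strong (@Phi_normal phi) ms) => [mi|I1].
  left; have [J [e' [m' [ee' ms' fE']]]] := A2 ax f.
  rewrite fE'; apply: epi_comp => //; apply: iso_epi.
  apply: (strong_onto_quotient_iso root_epi (@Phi_neq_one phi) ms').
  apply: (@epi_cancel _ _ _ _ _ e'); rewrite -comp_assoc -fE' fE.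
  by apply: epi_comp => //; exact: iso_epi.
right; subst I; have [k km] := point_surj m; exists k.
case: (branch_fibre k) => _ _ /(_ W f) [|g gE]; last by exists g.
by rewrite fE km; congr (_ ∘ _); exact: to_one.
Qed.

Lemma branch_not_epi W k (g : hom W (A k)) : ~ epi (branch k ∘ g).
Proof.
move=> /epi_comp /(_ root_epi); rewrite root_branch_comp => /epi_cancel.
by move=> /epi_one /(_ erefl); exact: Phi_neq_one.
Qed.

Lemma branch_index W k k' (g : hom W (A k)) (g' : hom W (A k')) :
  branch k ∘ g = branch k' ∘ g' -> k = k'.
Proof.
move=> /(congr1 (fun h => root ∘ h)); rewrite !root_branch_comp.
by move=> /bang_epi /point_inj.
Qed.

End Grow.

(** Both labels are normal quotients of the source. *)
Lemma epi_grow_label phi psi (A : 'I_(Phi_ar phi) -> C)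
    (B : 'I_(Phi_ar psi) -> C) (f : hom (@grow phi A) (@grow psi B)) :
  epi f -> phi = psi.
Proof.
move=> fe; have [||h hi _] := normal_quotient_unique (@root_epi phi A)
    (epi_comp fe (@root_epi psi B)) (@Phi_neq_one phi) (@Phi_neq_one psi).
- exact: Phi_normal.
- exact: Phi_normal.
case: phi psi {A B f fe} h hi => x hx [y hy] /= h /iso_obj xy; subst y.
by rewrite (Prop_irrelevance hx hy).
Qed.

(** [f] commutes with the roots, because the map to a normal quotient is unique; so it restricts to
    fibres. *)
Lemma epi_grow_branch phi (A B : 'I_(Phi_ar phi) -> C)
    (f : hom (@grow phi A) (@grow phi B)) k :
  epi f -> exists2 e : hom (A k) (B k), epi e & f ∘ branch A k = branch B k ∘ e.
Proof.
move=> fe; apply: (fibre_restrict fe _ (branch_fibre B k)).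
rewrite -[X in fibre X](@normal_quotient_eq _ _ (root A)) //.
- exact: branch_fibre.
- exact: root_epi.
- exact: epi_comp fe (@root_epi phi B).
- exact: Phi_neq_one.
exact: Phi_normal.
Qed.

Local Notation tree := (tree (@Phi_ar C one)).

Fixpoint obj_of (t : tree) : C :=
  match t with
  | leaf => one
  | node phi U => grow (fun k => obj_of (U k))
  end.

Definition branch_of phi (U : 'I_(Phi_ar phi) -> tree) k :
    hom (obj_of (U k)) (obj_of (node phi U)) :=
  branch (fun k => obj_of (U k)) k.

Lemma branch_of_not_epi phi (U : 'I_(Phi_ar phi) -> tree) W k
    (g : hom W (obj_of (U k))) : ~ epi (branch_of U k ∘ g).
Proof. exact: branch_not_epi. Qed.

(* [located a f]: the strong image of [f] is the subtree of [Y] at [a]. *)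
Fixpoint located (a : seq nat) : forall (Y : tree) W, hom W (obj_of Y) -> Prop :=
  match a with
  | [::] => fun (Y : tree) W f => epi f
  | p :: b => fun Y : tree =>
    match Y return forall W, hom W (obj_of Y) -> Prop with
    | leaf => fun W f => False
    | node phi U => fun W f =>
        exists (k : 'I_(Phi_ar phi)) (g : hom W (obj_of (U k))),
          [/\ val k = p, f = branch_of U k ∘ g & located b g]
    end
  end.

Lemma located_exists (Y : tree) W (f : hom W (obj_of Y)) : exists a, located a f.
Proof.
elim: Y W f => [|phi U IH] W f.
  by exists [::]; rewrite /= (to_one f (bang W)); exact: bang_epi.
case: (branch_or_epi f) => [fe|[k [g fg]]]; first by exists [::].
by have [a ga] := IH k W g; exists (val k :: a), k, g.
Qed.

Lemma located_pos a (Y : tree) W (f : hom W (obj_of Y)) : located a f -> pos Y a.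
Proof.
elim: a Y W f => [|p a IH] Y W f; first by move=> _; exact: pos_nil.
by case: Y f => [|phi U] f //= [k [g [<- _ /IH]]]; rewrite valK.
Qed.

Lemma located_unique a b (Y : tree) W (f : hom W (obj_of Y)) :
  located a f -> located b f -> a = b.
Proof.
elim: a b Y W f => [|p a IH] [|q b] [|phi U] W f //=.
- move=> fe [k [g [_ fE _]]]; case: (branch_of_not_epi (U := U) (g := g)).
  by rewrite -fE.
- move=> [k [g [_ fE _]]] fe; case: (branch_of_not_epi (U := U) (g := g)).
  by rewrite -fE.
move=> [k [g [<- fE ga]]] [l [h [<- fE' hb]]].
have kl : k = l.
  by apply: (@branch_index _ (fun k => obj_of (U k)) _ _ _ g h); rewrite -[LHS]fE.
subst l; have gh : g = h.
  by apply: (@branch_mono _ (fun k => obj_of (U k)) k); rewrite -[LHS]fE.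
by subst h; rewrite (IH _ _ _ _ ga hb).
Qed.

(** After composition with the root the two maps agree, so they have the same fibres over the label.
    On each of these fibres they restrict to epimorphisms onto a branch, equal by induction. *)
Lemma epi_to_tree_eq (Y : tree) W (d d' : hom W (obj_of Y)) :
  epi d -> epi d' -> d = d'.
Proof.
elim: Y W d d' => [|phi U IH] W d d' de d'e; first exact: to_one.
pose rt : hom (obj_of (node phi U)) (sval phi) := root (fun k => obj_of (U k)).
have rte : epi rt := @root_epi _ _.
have rd : rt ∘ d = rt ∘ d'.
  apply: normal_quotient_eq; [exact: epi_comp| exact: epi_comp | | exact: Phi_normal].
  exact: Phi_neq_one.
have agree k D (w : hom D W) : fibre (rt ∘ d) (point k) w -> d ∘ w = d' ∘ w.
  move=> fw; have fb := branch_fibre (fun k => obj_of (U k)) k.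
  have [e ee ->] := fibre_restrict de fw fb.
  move: fw; rewrite rd => fw; have [e' ee' ->] := fibre_restrict d'e fw fb.
  by rewrite (IH k _ _ _ ee ee').
(* [epi_eq] asks about the fibres of [d] and [d'] themselves; each of them lies inside a fibre of
   [rt ∘ d]. *)
have lift j A (u : hom A W) : rt ∘ d ∘ u = rt ∘ j ∘ bang A -> d ∘ u = d' ∘ u.
  have [k kj] := point_surj (rt ∘ j); rewrite -kj => du.
  have [D [w fw]] := fibre_exists (point k) (epi_comp de rte).
  by case: (fw) => _ _ /(_ _ _ du) [h <-]; rewrite !comp_assoc (agree _ _ _ fw).
apply: epi_eq => // j A u [du _ _].
  by rewrite -(lift j) // -comp_assoc du comp_assoc.
by rewrite (lift j) // rd -comp_assoc du comp_assoc.
Qed.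

Lemma located_eq a (Y : tree) W (f g : hom W (obj_of Y)) :
  located a f -> located a g -> f = g.
Proof.
elim: a Y W f g => [|p a IH] Y W f g; first exact: epi_to_tree_eq.
case: Y f g => [|phi U] f g //= [k [f' [<- -> fa]]] [l [g' [/val_inj kl -> ga]]].
by subst l; rewrite (IH _ _ _ _ fa ga).
Qed.

Lemma epi_prunes (X Y : tree) (f : hom (obj_of X) (obj_of Y)) :
  epi f -> prunes X Y.
Proof.
elim: Y X f => [|psi V IH] X f fe; first by constructor.
case: X f fe => [|phi U] f fe.
  by case: (@grow_neq_one psi (fun k => obj_of (V k))); exact: epi_one fe _.
have pp := epi_grow_label fe; subst psi; constructor => k.
by have [e ee _] := epi_grow_branch k fe; exact: IH ee.
Qed.

Lemma prunes_epi (X Y : tree) :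
  prunes X Y -> exists f : hom (obj_of X) (obj_of Y), epi f.
Proof.
elim=> [{}X|phi U V _ IH]; first by exists (bang _); exact: bang_epi.
apply: (epi_of_fibres (@point_inj phi) (@point_surj phi)) IH.
- exact: root_epi.
- exact: root_epi.
- exact: Phi_neq_one.
- by move=> k; exists (branch (fun k => obj_of (U k)) k); exact: branch_fibre.
by move=> k; exists (branch (fun k => obj_of (V k)) k); exact: branch_fibre.
Qed.

Lemma located_prunes a (X Y : tree) (f : hom (obj_of X) (obj_of Y)) :
  located a f -> prunes X (subtree Y a).
Proof.
elim: a Y f => [|p a IH] Y f; first by rewrite subtree_nil; exact: epi_prunes.
by case: Y f => [|phi U] f //= [k [g [<- _ /IH]]]; rewrite valK.
Qed.

Lemma prunes_located a (X Y : tree) :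
  pos Y a -> prunes X (subtree Y a) ->
  exists f : hom (obj_of X) (obj_of Y), located a f.
Proof.
elim: a Y => [|p a IH] Y; first by rewrite subtree_nil => _; exact: prunes_epi.
case: Y => [|phi U] //=; case: insubP => // k kp ke /IH{}IH /IH [f fa].
by exists (branch_of U k ∘ f), k, f.
Qed.

(** An epimorphism [g] carries branches onto the branches of its target with the same index, so [a]
    survives as long as the target has nodes. Once a leaf is reached, the composite is epi and the
    address stops. *)
Lemma located_comp a b (Y Z : tree) W (f : hom W (obj_of Y))
    (g : hom (obj_of Y) (obj_of Z)) :
  located a f -> located b g ->
  located (b ++ pos_lp (subtree Z b) a) (g ∘ f).
Proof.
move=> fa; elim: b Z g => [|q b IHb] Z g; last first.
  case: Z g => [|phi U] g //= [k [g' [<- -> /IHb hg]]].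
  by exists k, (g' ∘ f); rewrite valK comp_assoc.
rewrite subtree_nil /=; elim: a Y Z W f g fa => [|p a IH] Y Z W f g.
  by move=> /= fe ge; exact: epi_comp.
case: Z g => [|psi V] g fa ge.
  by rewrite /= (to_one (g ∘ f) (bang W)); exact: bang_epi.
case: Y f g fa ge => [|phi U] f g //= [k [f' [<- -> fa]]] ge.
have pp := epi_grow_label ge; subst psi; rewrite valK.
have [e ee eE] := epi_grow_branch k ge.
exists k, (e ∘ f'); split=> //; last exact: IH.
by rewrite !comp_assoc; congr (_ ∘ _).
Qed.

(** For equal objects the identity is an epimorphism in both directions, so each tree prunes to the
    other. *)
Lemma obj_of_inj : injective obj_of.
Proof.
suff H (X Y : tree) : obj_of X = obj_of Y -> prunes X Y.
  by move=> X Y XY; apply: prunes_antisym; exact: H.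
move=> XY; suff [f fe] : exists f : hom (obj_of X) (obj_of Y), epi f.
  exact: epi_prunes fe.
by rewrite XY; exists (idm _); exact/iso_epi/iso_id.
Qed.

Lemma obj_of_surj X : exists t, obj_of t = X.
Proof.
elim/strong_ind: X => X IH.
have [->|X1] := pselect (X = one); first by exists leaf.
have [N [d [de N1 nN]]] := normal_exists X1.
have [phi pN] := normal_Phi N1 nN; subst N.
have [k|U UE] := @choice _ _
    (fun k (t : tree) => exists u : hom (obj_of t) X, fibre d (point k) u).
  have [A [u fu]] := fibre_exists (point k) de.
  have [|t tA] := IH A u (fibre_strong fu); last by subst A; exists t, u.
  (* If the fibre were all of [X], the epimorphism [d] would factor through a point, forcing its
     target to be [one]. *)
  move=> /iso_epi /epi_comp /(_ de); case: fu => -> _ _ /epi_cancel /epi_one.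
  by move=> /(_ erefl).
exists (node phi U).
have [j|h hi _] := rigidity (@root_epi phi (fun k => obj_of (U k))) de N1.
  have [k <-] := point_surj j; have [u fu] := UE k.
  exists (obj_of (U k)), (branch (fun k => obj_of (U k)) k), u.
  by split=> //; exact: branch_fibre.
exact: iso_obj hi.
Qed.

(** The choice is harmless: by [located_eq] only one morphism sits at a given address. *)
Definition hom_of (X Y : tree) (m : matching X Y) : hom (obj_of X) (obj_of Y).
Proof.
apply: projT1 (cid (@prunes_located (match_address m) X Y _ _)).
  by case: m => T d [].
by case: m => T d [a pa sa]; rewrite /match_address /= sa.
Defined.

Lemma hom_of_located (X Y : tree) (m : matching X Y) :
  located (match_address m) (hom_of m).
Proof. exact: projT2 (cid _). Qed.

Lemma hom_of_id (X : tree) : hom_of (matching_id X) = idm (obj_of X).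
Proof.
apply: located_eq (hom_of_located _) _; exact/iso_epi/iso_id.
Qed.

Lemma hom_of_comp (X Y Z : tree) (g : matching Y Z) (f : matching X Y) :
  hom_of (matching_comp g f) = hom_of g ∘ hom_of f.
Proof.
apply: located_eq (hom_of_located _) _.
have := located_comp (hom_of_located f) (hom_of_located g).
case: g => S e [b pb sb]; rewrite /match_address /=; subst S.
by [].
Qed.

Definition tree_functor : functor (tree_cat (@Phi_ar C one)) C :=
  @Functor (tree_cat (@Phi_ar C one)) C obj_of hom_of hom_of_id hom_of_comp.

Lemma hom_of_bij (X Y : tree) (f : hom (obj_of X) (obj_of Y)) :
  exists2 m, hom_of m = f & forall m', hom_of m' = f -> m' = m.
Proof.
have [a fa] := located_exists f.
pose m := Matching (located_prunes fa) (Occurrence (located_pos fa) erefl).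
have mf : hom_of m = f by exact: (located_eq (hom_of_located m : located a _) fa).
exists m => // m' m'f; apply: matching_eq.
apply: (located_unique _ (fa : located (match_address m) f)).
by rewrite -m'f; exact: hom_of_located.
Qed.

End NineAx.

(** * Isomorphisms of categories *)

Section Isomorphism.

Definition cast_hom (C : category) (X X' Y Y' : C) (e : X = X') (e' : Y = Y')
    (f : hom X Y) : hom X' Y' :=
  match e in _ = Z, e' in _ = Z' return hom Z Z' with
  | erefl, erefl => f
  end.

Lemma cast_homK (C : category) (X X' Y Y' : C) (e : X = X') (d : X' = X)
    (e' : Y = Y') (d' : Y' = Y) (f : hom X Y) :
  cast_hom d d' (cast_hom e e' f) = f.
Proof.
case: _ / e d; case: _ / e' d' => d' d.
by rewrite (Prop_irrelevance d erefl) (Prop_irrelevance d' erefl).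
Qed.

Lemma functor_eq (C D : category) (F G : functor C D)
    (e : forall X : C, F X = G X) :
  (forall (X Y : C) (f : hom X Y), cast_hom (e X) (e Y) (fmap F f) = fmap G f) ->
  F = G.
Proof.
case: F G e => Fo Ff Fi Fc [Go Gf Gi Gc] /= e h.
have eo : Fo = Go by exact/funext.
subst Go.
have ef : Ff = Gf.
  apply/functional_extensionality_dep => X; apply/functional_extensionality_dep => Y.
  apply/functional_extensionality_dep => f; rewrite -h.
  by rewrite (Prop_irrelevance (e X) erefl) (Prop_irrelevance (e Y) erefl).
subst Gf; congr Functor; exact: Prop_irrelevance.
Qed.

Variables (C D : category) (H : functor D C).
Hypotheses (H_inj : injective H) (H_surj : forall X : C, exists Y : D, H Y = X).
Hypothesis H_ff : forall (X Y : D) (f : hom (H X) (H Y)),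
  exists2 m : hom X Y, fmap H m = f & forall m', fmap H m' = f -> m' = m.

Let pre (X : C) : D := projT1 (cid (H_surj X)).

Let preK (X : C) : H (pre X) = X := projT2 (cid (H_surj X)).

Let preH (Y : D) : pre (H Y) = Y := H_inj (preK (H Y)).

Let lift (X Y : D) (f : hom (H X) (H Y)) : hom X Y := projT1 (cid2 (H_ff f)).

Let liftK (X Y : D) (f : hom (H X) (H Y)) : fmap H (lift f) = f.
Proof. by rewrite /lift; case: cid2. Qed.

Let fmap_inj (X Y : D) (m m' : hom X Y) : fmap H m = fmap H m' -> m = m'.
Proof. by have [n _ nu] := H_ff (fmap H m') => h; rewrite (nu m) // (nu m'). Qed.

Let inv_map (X Y : C) (f : hom X Y) : hom (pre X) (pre Y) :=
  lift (cast_hom (esym (preK X)) (esym (preK Y)) f).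

Let inv_id (X : C) : inv_map (idm X) = idm (pre X).
Proof.
apply: fmap_inj; rewrite liftK fmap_id.
by case: _ / (esym (preK X)).
Qed.

Let inv_comp (X Y Z : C) (g : hom Y Z) (f : hom X Y) :
  inv_map (g ∘ f) = inv_map g ∘ inv_map f.
Proof.
apply: fmap_inj; rewrite fmap_comp !liftK.
by case: _ / (esym (preK X)); case: _ / (esym (preK Y)); case: _ / (esym (preK Z)).
Qed.

(** Preimages of objects are chosen, so the inverse laws hold only after transport along [preK] and
    [preH]; [functor_eq] turns this into equality of functors. *)
Lemma bijective_functor_inverse :
  exists F : functor C D, functor_comp F H = functor_id D /\
    functor_comp H F = functor_id C.
Proof.
pose F := Functor inv_id inv_comp; exists F; split.
  apply: (@functor_eq _ _ (functor_comp F H) (functor_id D) preH) => X Y f /=.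
  apply: fmap_inj.
  have fcast (X1 X2 Y1 Y2 : D) (e : X1 = X2) (e' : Y1 = Y2) (g : hom X1 Y1) :
      fmap H (cast_hom e e' g) = cast_hom (f_equal H e) (f_equal H e') (fmap H g).
    by case: _ / e; case: _ / e'.
  rewrite fcast liftK.
  exact: cast_homK.
apply: (@functor_eq _ _ (functor_comp H F) (functor_id C) preK) => X Y f /=.
rewrite liftK.
exact: cast_homK.
Qed.

Lemma bijective_functor_epi (X Y : D) (e : hom X Y) : epi (fmap H e) <-> epi e.
Proof.
split=> ee W a b.
  by move=> ab; apply/fmap_inj/ee; rewrite -!fmap_comp ab.
have [Z ZW] := H_surj W; subst W.
rewrite -(liftK a) -(liftK b) -!fmap_comp => /fmap_inj.
by move=> /ee ->.
Qed.

Lemma bijective_functor_strong (X Y : D) (m : hom X Y) :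
  strong_mono (fmap H m) <-> strong_mono m.
Proof.
split=> -[mm sm]; split.
- move=> W a b ab; apply/fmap_inj/mm; rewrite -!fmap_comp; congr fmap; exact: ab.
- move=> P Q e a b ee ab.
  have [||l [le ml]] := sm _ _ (fmap H e) (fmap H a) (fmap H b).
  - exact/bijective_functor_epi.
  - by rewrite -!fmap_comp ab.
  exists (lift l); split; apply: fmap_inj; by rewrite fmap_comp liftK.
- move=> W a b; have [Z ZW] := H_surj W; subst W.
  rewrite -(liftK a) -(liftK b) -!fmap_comp => /fmap_inj.
  by move=> /mm ->.
move=> P Q e a b; have [P' PP] := H_surj P; have [Q' QQ] := H_surj Q; subst P Q.
rewrite -(liftK e) -(liftK a) -(liftK b) -!fmap_comp => /bijective_functor_epi ee.
move=> /fmap_inj /(sm _ _ _ _ _ ee) [l [<- <-]].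
by exists (fmap H l); rewrite !fmap_comp.
Qed.

End Isomorphism.

(** Stated for a variable [K], so that it can be rewritten although the type of [fmap K e] depends
    on it. *)
Lemma functor_eq_id_epi (C : category) (K : functor C C) (X Y : C) (e : hom X Y) :
  K = functor_id C -> epi (fmap K e) <-> epi e.
Proof. by move->. Qed.

Lemma functor_eq_id_strong (C : category) (K : functor C C) (X Y : C) (e : hom X Y) :
  K = functor_id C -> strong_mono (fmap K e) <-> strong_mono e.
Proof. by move->. Qed.

(** * Expression tree categories *)

Section Trees.
Variables (L : Type) (ar : L -> nat).
Local Notation tree := (tree ar).
Local Notation T := (tree_cat ar).
Implicit Types (X Y Z W A B S : tree) (a b : seq nat).

Lemma cat_inj a b b' : a ++ b = a ++ b' -> b = b'.
Proof. by move/(congr1 (drop (size a))); rewrite !drop_size_cat. Qed.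

Lemma prefix_comparable a b a' b' :
  a ++ a' = b ++ b' -> prefix b a \/ prefix a b.
Proof.
move=> ab; have [ba|/ltnW ab'] := leqP (size b) (size a); [left|right].
  by rewrite prefixE -(takel_cat a' ba) ab take_size_cat.
by rewrite prefixE -(takel_cat b' ab') -ab take_size_cat.
Qed.

Lemma prunes_leafE X : prunes leaf X -> X = leaf.
Proof. by case: X => // l U YX; have [] := prunes_nodeE YX. Qed.

Lemma pos_catE X a b : pos X (a ++ b) = pos X a && pos (subtree X a) b.
Proof.
elim: a X => [|p a IH] X; first by rewrite subtree_nil pos_nil.
by case: X => [|l U] //=; case: insub.
Qed.

Lemma pos_lp_nil X : pos_lp X [::] = [::].
Proof. by case: X. Qed.

Lemma pos_lp_catE X a b :
  pos X a -> pos_lp X (a ++ b) = a ++ pos_lp (subtree X a) b.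
Proof.
elim: a X => [|p a IH] X; first by rewrite subtree_nil.
by case: X => [|l U] //=; case: insub => // i /IH ->.
Qed.

Lemma prunes_pos X Y a : prunes X Y -> pos Y a -> pos X a.
Proof.
move=> XY; elim: XY a => [{}X|l U V _ IH] [|p a] //=.
by case: insub => // i; exact: IH.
Qed.

Lemma prunes_subtree_pos X Y a :
  prunes X Y -> pos Y a -> prunes (subtree X a) (subtree Y a).
Proof.
move=> XY Ya; rewrite -[a in subtree Y a](pos_lp_id Ya).
by apply: prunes_subtree => //; exact: prunes_pos Ya.
Qed.

(** Refers to [Z] instead of the pruned tree [mid g], so that equations between matchings become
    equations between words. *)
Lemma match_address_comp X Y Z (g : matching Y Z) (f : matching X Y) :
  match_address (matching_comp g f) =
  match_address g ++ pos_lp (subtree Z (match_address g)) (match_address f).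
Proof. by case: g => S e [b pb sb]; rewrite /match_address /=; subst S. Qed.

Lemma match_address_pos X Y (m : matching X Y) : pos Y (match_address m).
Proof. by case: m => S d []. Qed.

Lemma match_address_prunes X Y (m : matching X Y) :
  prunes X (subtree Y (match_address m)).
Proof. by case: m => S d [a pa sa]; rewrite /match_address /= sa. Qed.

Lemma occurrenceP X Y (m : matching X Y) :
  is_occurrence m <-> subtree Y (match_address m) = X.
Proof. by case: m => S d [a pa sa]; rewrite /is_occurrence /match_address /= sa. Qed.

Definition matching_at X Y a (Ya : pos Y a) (XY : prunes X (subtree Y a)) :
  matching X Y := Matching XY (Occurrence Ya erefl).

Definition pruning X Y (XY : prunes X Y) : matching X Y :=
  Matching XY (occ_whole Y).

Definition subtree_occ X a (Xa : pos X a) : matching (subtree X a) X :=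
  Matching (prunes_refl _) (Occurrence Xa erefl).

Lemma pruning_prunes X Y (m : matching X Y) : is_pruning m -> prunes X Y.
Proof. by move=> m0; have := match_address_prunes m; rewrite m0 subtree_nil. Qed.

Lemma comp_pruning_r X Y Z (g : matching Y Z) (f : matching X Y) :
  is_pruning f -> match_address (matching_comp g f) = match_address g.
Proof. by rewrite match_address_comp => ->; rewrite pos_lp_nil cats0. Qed.

Lemma comp_pruning_l X Y Z (g : matching Y Z) (f : matching X Y) :
  is_pruning g -> match_address (matching_comp g f) = pos_lp Z (match_address f).
Proof. by rewrite match_address_comp => ->; rewrite subtree_nil. Qed.

Lemma comp_occurrence_l X Y Z (g : matching Y Z) (f : matching X Y) :
  is_occurrence g ->
  match_address (matching_comp g f) = match_address g ++ match_address f.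
Proof.
move=> /occurrenceP gE; rewrite match_address_comp gE pos_lp_id //.
exact: match_address_pos.
Qed.

Lemma tree_epiP X Y (m : @hom T X Y) : epi m <-> is_pruning m.
Proof.
split=> [me|m0 W a b /(congr1 (@match_address _ _ _ _))]; last first.
  by rewrite !comp_pruning_r // => /matching_eq.
rewrite /is_pruning; case E: (match_address m) => [//|p a]; exfalso.
have := match_address_pos m; rewrite E.
case: Y m me E => [//|l U] m me E /=; case: insubP => // i pl ip _.
(* Pruning to [W] and pruning to its leaf at [p] are different maps, but they agree on everything
   below place [p]. *)
pose W : tree := node l (fun=> leaf).
have Wp : pos W [:: p] by rewrite /= -ip valK.
have Wl : subtree W [:: p] = leaf by rewrite /= -ip valK.
have f1 : prunes (node l U) W by constructor => q; constructor.
have f2 : prunes (node l U) (subtree W [:: p]) by rewrite Wl; constructor.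
have /(congr1 (@match_address _ _ _ _)) // : pruning f1 = matching_at Wp f2.
apply: me; apply: matching_eq; rewrite !match_address_comp E.
by rewrite {1}/match_address /= -ip valK !pos_lp_leaf.
Qed.

Lemma tree_strongP X Y (m : @hom T X Y) : strong_mono m <-> is_occurrence m.
Proof.
split=> [[mm sm]|mo].
  have fE : m = matching_comp (matching_at (match_address_pos m) (prunes_refl _) :
      matching _ Y) (pruning (match_address_prunes m)).
    apply: matching_eq; rewrite match_address_comp.
    by rewrite /match_address /= cats0.
  (* Lifting the identity of [X] against the pruning part of [m] gives a retraction of that pruning,
     which therefore cuts nothing. *)
  have [||l [le _]] := sm _ _ (pruning (match_address_prunes m) : @hom T _ _) (idm _)
    (matching_at (match_address_pos m) (prunes_refl _)).
  - exact/tree_epiP.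
  - by rewrite comp_idr {1}fE.
  apply/occurrenceP; apply: prunes_antisym; last exact: match_address_prunes.
  apply: (@pruning_prunes _ _ l); have := congr1 (@match_address _ _ _ _) le.
  by rewrite comp_pruning_r.
have mE := (occurrenceP m).1 mo.
split=> [W a b /(congr1 (@match_address _ _ _ _))|P Q e a b /tree_epiP e0].
  by rewrite !comp_occurrence_l // => /cat_inj /matching_eq.
move=> /(congr1 (@match_address _ _ _ _)).
rewrite comp_occurrence_l // comp_pruning_r // => mab.
have Qp : prunes Q (subtree X (match_address a)).
  have := match_address_prunes b; rewrite -mab subtree_cat ?mE //.
  exact: match_address_pos.
exists (matching_at (match_address_pos a) Qp); split; apply: matching_eq.
  by rewrite comp_pruning_r.
by rewrite comp_occurrence_l.
Qed.

Lemma tree_iso_obj X Y (m : @hom T X Y) : is_iso m -> X = Y.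
Proof.
move=> mi; have /tree_epiP m0 := iso_epi mi.
have /tree_strongP /occurrenceP := iso_strong mi.
by rewrite m0 subtree_nil.
Qed.

Lemma pruning_identity X Y (m : @hom T X Y) : is_pruning m -> X = Y -> is_identity m.
Proof.
move=> m0 XY; subst Y; rewrite (_ : m = idm (X : T)); first exact: Is_identity.
exact: matching_eq.
Qed.

(** The pullback is the subtree of [X] at the address of [v]. If a map into [X] lies over [v] after
    pruning, then the address of [v] is a prefix of the pruned address, hence of the original one;
    what remains is the address of the induced map. *)
Lemma tree_pullback X Y B P (d : @hom T X Y) (v : @hom T B Y) (p : @hom T P X)
    (q : @hom T P B) :
  is_pruning d -> is_occurrence v -> is_occurrence p -> is_pruning q ->
  match_address p = match_address v -> is_pullback d v p q.
Proof.
move=> d0 vo po q0 pv; have vE := (occurrenceP v).1 vo; have pE := (occurrenceP p).1 po.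
split.
  apply: matching_eq; rewrite comp_pruning_l // comp_occurrence_l // q0 cats0 pv.
  by rewrite pos_lp_id //; exact: match_address_pos.
move=> W a b /(congr1 (@match_address _ _ _ _)).
rewrite comp_pruning_l // comp_occurrence_l // => dab.
have /prefixP [c aE] : prefix (match_address v) (match_address a).
  apply: (@prefix_trans _ (pos_lp Y (match_address a))); last first.
    by case: (pos_lpP Y (match_address a)).
  by rewrite dab; exact: prefix_prefix.
have ap := match_address_pos a; have aW := match_address_prunes a.
have Pc : pos P c by move: ap; rewrite aE pos_catE -pv pE => /andP[].
have Wc : prunes W (subtree P c).
  by rewrite -pE -subtree_cat ?pv -?aE // -pv; exact: match_address_pos.
exists (matching_at Pc Wc); split.
  split; apply: matching_eq; first by rewrite comp_occurrence_l // pv aE.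
  rewrite comp_pruning_l //; apply: (@cat_inj (match_address v)); rewrite -dab aE.
  by rewrite pos_lp_catE ?vE //; exact: match_address_pos.
move=> h [/(congr1 (@match_address _ _ _ _)) + _].
rewrite comp_occurrence_l // => pha; apply: matching_eq.
by apply: (@cat_inj (match_address p)); rewrite pha pv aE.
Qed.

Lemma leaf_terminal : is_terminal (leaf : T).
Proof.
move=> X; exists (pruning (prunes_leaf X)) => q; apply: matching_eq.
by have := match_address_pos q; case: (match_address q).
Qed.

Lemma point_address Y (j : @hom T leaf Y) : subtree Y (match_address j) = leaf.
Proof. exact/prunes_leafE/match_address_prunes. Qed.

Lemma tree_pullback_iso_at X Y (d : @hom T X Y) (j : @hom T leaf Y) :
  is_pruning d -> pullback_iso_at d j <-> subtree X (match_address j) = leaf.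
Proof.
move=> d0; have Xj := prunes_pos (pruning_prunes d0) (match_address_pos j).
pose p : @hom T _ X := subtree_occ Xj.
pose q : @hom T (subtree X (match_address j)) leaf := pruning (prunes_leaf _).
have pb : is_pullback d j p q.
  by apply: tree_pullback => //; exact/occurrenceP/point_address.
split=> [[P' [p' [q' [pb' q'i]]]]|Xl].
  have [k ki _] := pullback_unique pb' pb.
  by rewrite (tree_iso_obj ki) (tree_iso_obj q'i).
exists _, p, q; split=> //; apply: identity_iso; exact: pruning_identity.
Qed.

(** Replaces the subtree at [a] by [B], and is used only at positions. It provides the pushouts of
    A4, where that subtree prunes to [B], and the fillings of A6, where it is a leaf. *)
Fixpoint graft (X : tree) (a : seq nat) (B : tree) {struct a} : tree :=
  match a, X with
  | [::], _ => B
  | p :: b, node l U => node l (fun i => if val i == p then graft (U i) b B else U i)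
  | _ :: _, leaf => leaf
  end.

Lemma graft_nil X B : graft X [::] B = B.
Proof. by case: X. Qed.

Lemma pos_graft X a B : pos X a -> pos (graft X a B) a.
Proof.
elim: a X => [|p a IH] X; first by rewrite !pos_nil.
by case: X => [|l U] //=; case: insubP => // i _ ip; rewrite ip eqxx; exact: IH.
Qed.

Lemma subtree_graft X a B : pos X a -> subtree (graft X a B) a = B.
Proof.
elim: a X => [|p a IH] X; first by rewrite subtree_nil graft_nil.
by case: X => [|l U] //=; case: insubP => // i _ ip; rewrite ip eqxx; exact: IH.
Qed.

Lemma prunes_graft Y X a B :
  prunes Y X -> pos X a -> prunes (subtree Y a) B -> prunes Y (graft X a B).
Proof.
elim: a Y X => [|p a IH] Y X YX; first by rewrite subtree_nil graft_nil.
case: X YX => [|l U] // YX; have [V YE VU] := prunes_nodeE YX; subst Y => /=.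
case: insubP => // i _ ip Ua VB; constructor => k.
by case: eqP => // kp; have -> : k = i; [exact/val_inj/(etrans kp)|exact: IH].
Qed.

(** Governs maps out of a graft, as [prunes_graft] governs maps into it. *)
Lemma graft_prunes X a B S :
  pos X a -> prunes X S -> prunes B (subtree S (pos_lp S a)) ->
  prunes (graft X a B) S.
Proof.
elim: a X S => [|p a IH] X S; first by rewrite pos_lp_nil subtree_nil graft_nil.
case: X => [|l U] // Xa XS; case: XS Xa => [Y _ _|l' U' V UV /=]; first by constructor.
case E: (insub p) => [i|//] Ua; rewrite /= E => BS; constructor => k.
case: eqP => // kp; have ki : k = i.
  by move: E; case: insubP => // u _ up [<-]; apply: val_inj; rewrite up.
by subst k; exact: IH.
Qed.

(** Points of a tree are its leaves, so this locates the fibres that a graft can change. *)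
Lemma graft_leaf X a B b :
  pos X a -> pos (graft X a B) b -> subtree (graft X a B) b = leaf ->
  subtree X b = leaf \/ exists c, b = a ++ c.
Proof.
elim: a X b => [|p a IH] X b; first by move=> *; right; exists b.
case: X => [|l U] //=; case: insubP => // i _ ip Ua.
case: b => [|q b] //=; case: insubP => // k _ kq; case: eqP => [kp|_]; last by left.
have ki : k = i by exact/val_inj/(etrans kp).
subst k; move=> /(IH _ _ Ua) h /h [->|[c ->]]; first by left.
by right; exists c; rewrite -kq ip.
Qed.

(** The core of A9: a proper pruning replaces some larger subtree of [X] by a leaf of [Y]. *)
Lemma prunes_eq X Y :
  prunes X Y ->
  (forall a, pos Y a -> subtree Y a = leaf -> subtree X a = leaf) -> X = Y.
Proof.
move=> XY; elim: XY => [{}X|l U V _ IH] XYl.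
  by have := XYl [::]; rewrite !subtree_nil; apply.
congr node; apply/funext => k; apply: IH => a Va Vl.
by have := XYl (val k :: a); rewrite /= valK; apply.
Qed.

(** The last two clauses go beyond A4 and serve A5: every nontrivial fibre of [c] comes from one of
    [a]. *)
Lemma tree_A4 A X B (u : @hom T A X) (a : @hom T A B) :
  strong_mono u -> epi a ->
  exists Y (c : @hom T X Y) (v : @hom T B Y),
    [/\ is_pushout u a c v, strong_mono v, is_pullback c v u a, is_pruning c &
        forall j : @hom T leaf Y, ~ pullback_iso_at c j ->
          exists2 t : @hom T leaf B, j = v ∘ t & ~ pullback_iso_at a t].
Proof.
move=> /tree_strongP uo /tree_epiP a0; have uE := (occurrenceP u).1 uo.
have ux := match_address_pos u; have ab := pruning_prunes a0.
pose Y := graft X (match_address u) B.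
have Yu : pos Y (match_address u) by exact: pos_graft.
have YB : subtree Y (match_address u) = B by exact: subtree_graft.
have XY : prunes X Y by apply: prunes_graft => //; [exact: prunes_refl|rewrite uE].
have BY : prunes B (subtree Y (match_address u)) by rewrite YB; exact: prunes_refl.
pose c : @hom T X Y := pruning XY.
pose v : @hom T B Y := matching_at Yu BY.
have vo : is_occurrence v by exact/occurrenceP.
have pb : is_pullback c v u a by exact: tree_pullback.
exists Y, c, v; split=> //; [split; first by case: pb| exact/tree_strongP |].
  move=> W f g /(congr1 (@match_address _ _ _ _)).
  rewrite match_address_comp comp_pruning_r // => fg.
  have YW : prunes Y (subtree W (match_address f)).
    apply: graft_prunes => //; first exact: match_address_prunes.
    have := match_address_prunes g; rewrite -fg subtree_cat //.
    exact: match_address_pos.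
  exists (matching_at (match_address_pos f) YW); split.
    split; apply: matching_eq; first by rewrite comp_pruning_r.
    by rewrite match_address_comp -fg.
  move=> h [/(congr1 (@match_address _ _ _ _)) + _].
  by rewrite comp_pruning_r // => hf; exact: matching_eq.
move=> j jn; have jY := match_address_pos j; have jl := point_address j.
have [Xj|[b jb]] := graft_leaf ux jY jl.
  by case: jn; exact/tree_pullback_iso_at.
have Bb : pos B b by move: jY; rewrite jb pos_catE YB => /andP[].
have Bl : subtree B b = leaf by rewrite -YB -subtree_cat // -jb.
have lb : prunes leaf (subtree B b) by rewrite Bl; constructor.
exists (matching_at Bb lb); first by apply: matching_eq; rewrite comp_occurrence_l.
move=> /(tree_pullback_iso_at _ a0) Al; apply: jn; apply/tree_pullback_iso_at => //.
by rewrite jb subtree_cat // uE.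
Qed.

Lemma one_point_iso (C : category) (one X Y Y' : C) (c : hom X Y) (h : hom Y Y') :
  is_terminal one -> is_iso h -> one_point_epi one c -> one_point_epi one (h ∘ c).
Proof.
move=> ot hi [ce cj]; split; first by apply: epi_comp => //; exact: iso_epi.
have [l li [lh hl]] := iso_sym hi.
have H (j : hom one Y') : ~ pullback_iso_at (h ∘ c) j -> ~ pullback_iso_at c (l ∘ j).
  rewrite !(uniq_liftP ot) => hn cn; apply: hn.
  rewrite -[j]comp_idl -hl -comp_assoc; exact: uniq_lift_comp.
move=> j j' /H jn /H jn'; apply: (iso_mono li); exact: cj.
Qed.

Lemma tree_A5 A B X Y (a : @hom T A B) (u : @hom T A X) (c : @hom T X Y)
    (v : @hom T B Y) :
  one_point_epi (leaf : T) a -> strong_mono u -> is_pushout u a c v ->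
  one_point_epi (leaf : T) c.
Proof.
move=> [ae aj] us po.
have [Y' [c' [v' [po' vs' _ c0 cj]]]] := tree_A4 us ae.
have [k ki [<- _]] := pushout_unique po' po.
apply: one_point_iso => //; first exact: leaf_terminal.
split; first exact/tree_epiP.
move=> j j' /cj [t -> tn] /cj [t' -> tn'].
by rewrite (aj t t').
Qed.

(** The terminal object grafts [A] onto the leaf [j]. In any other object the pullback condition
    forces [A] to sit at this address too, so that object prunes to the graft. *)
Lemma tree_A6 A B (j : @hom T leaf B) : exists S : fill_cat (A : T) j, is_terminal S.
Proof.
have Bj := match_address_pos j; have jl := point_address j.
pose D := graft B (match_address j) A.
have Dj : pos D (match_address j) by exact: pos_graft.
have DA : subtree D (match_address j) = A by exact: subtree_graft.
have DB : prunes D B.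
  apply: graft_prunes => //; first exact: prunes_refl.
  by rewrite pos_lp_id // jl; constructor.
have AD : prunes A (subtree D (match_address j)) by rewrite DA; exact: prunes_refl.
pose d : @hom T D B := pruning DB.
pose u : @hom T A D := matching_at Dj AD.
have uo : is_occurrence u by exact/occurrenceP.
have jo : is_occurrence j by exact/occurrenceP.
have de : epi d by exact/tree_epiP.
have us : strong_mono u by exact/tree_strongP.
have pb (q : @hom T A leaf) : is_pullback d j u q.
  apply: tree_pullback => //; rewrite (to_one leaf_terminal q (pruning (prunes_leaf A))).
  by [].
exists (FillObj de us pb) => -[D' d' u' de' us' pb'].
have d'0 := (tree_epiP d').1 de'; have u'o := (tree_strongP u').1 us'.
have D'B := pruning_prunes d'0; have D'j := prunes_pos D'B Bj.
have u'j : match_address u' = match_address j.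
  have pbj : is_pullback d' j (subtree_occ D'j : @hom T _ _)
      (pruning (prunes_leaf _) : @hom T _ leaf).
    exact: tree_pullback.
  have [k ki [<- _]] := pullback_unique pbj (pb' (pruning (prunes_leaf A))).
  have /tree_epiP k0 := iso_epi ki.
  by rewrite comp_pruning_r.
have D'A : subtree D' (match_address j) = A.
  by rewrite -u'j; exact: (occurrenceP u').1.
have D'D : prunes D' D by apply: prunes_graft => //; rewrite D'A; exact: prunes_refl.
pose h : @hom T D' D := pruning D'D.
have hu : h ∘ u' = u by apply: matching_eq; rewrite comp_pruning_l // u'j pos_lp_id.
have dh : d ∘ h = d' by apply: matching_eq; rewrite comp_pruning_l // d'0 pos_lp_nil.
exists (exist _ h (conj hu dh)) => -[k [ku dk]]; apply: fill_hom_eq; apply: matching_eq.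
rewrite /= in k ku dk *.
(* The address of [k] is a prefix of that of [j], hence a position of [B], which [d] does not
   shorten; so it is empty. *)
have := congr1 (@match_address _ _ _ _) dk; rewrite comp_pruning_l // d'0.
rewrite pos_lp_id //; have := congr1 (@match_address _ _ _ _) ku.
rewrite match_address_comp u'j => kj.
by have := Bj; rewrite -[match_address j]kj pos_catE => /andP[].
Qed.

Lemma finite_positions X : finite_set [set a | pos X a]%classic.
Proof.
elim: X => [|l U IH].
  by apply: sub_finite_set (finite_set1 [::]) => -[].
apply: (@sub_finite_set _ _ ([set [::]] `|`
    \bigcup_(k in [set: 'I_(ar l)]) (cons (val k) @` [set a | pos (U k) a]))%classic).
  move=> [|p a] /=; first by left.
  by case: insubP => // k _ <- Ua; right; exists k => //; exists a.
rewrite finite_setU; split; first exact: finite_set1.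
apply: bigcup_finite => [|k _]; first exact: finite_finset.
exact: finite_image.
Qed.

Lemma finite_prunings X : finite_set [set Y | prunes X Y]%classic.
Proof.
elim: X => [|l U IH].
  by apply: sub_finite_set (finite_set1 leaf) => Y /prunes_leafE ->.
(* The prunings of all branches are pooled in one finite set, so that the pruned nodes come from
   finite functions into it. *)
pose F : set {classic tree} :=
  (\bigcup_(k in [set: 'I_(ar l)]) [set Y | prunes (U k) Y])%classic.
have fF : finite_set F.
  by apply: bigcup_finite => [|k _]; [exact: finite_finset|exact: IH].
pose g (f : {ffun 'I_(ar l) -> fset_set F}) : tree := node l (fun k => val (f k)).
apply: (@sub_finite_set _ _ ([set leaf] `|` g @` [set: _])%classic).
  move=> Y /= UY; case: Y UY => [|l' V] UY; first by left.
  have [W UW WV] := prunes_nodeE UY; right.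
  have el : l = l' by case: UW.
  subst l'; rewrite -(node_inj UW) in WV.
  have VF k : (V k : {classic tree}) \in fset_set F.
    by rewrite in_fset_set // inE; exists k => //; exact: WV.
  exists [ffun k => FSetSub (VF k)] => //; rewrite /g; congr node.
  by apply/funext => k; rewrite ffunE.
rewrite finite_setU; split; first exact: finite_set1.
by apply: finite_image; exact: finite_finset.
Qed.

Lemma tree_A7 X :
  finite_set [set m : {A : T & @hom T A X} | strong_mono (projT2 m)]%classic /\
  finite_set [set e : {B : T & @hom T X B} | epi (projT2 e)]%classic.
Proof.
split.
  (* The default values of this [g] and of the next only make the functions total. *)
  pose g a : {A : T & @hom T A X} :=
    if pselect (pos X a) is left Xa then existT _ (subtree X a) (subtree_occ Xa)
    else existT _ X (matching_id X).
  apply: sub_finite_set (finite_image g (finite_positions X)) => -[A m] /= /tree_strongP.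
  case: m => S d [a Xa sa]; rewrite /is_occurrence /= => SA; subst A S.
  exists a => //; rewrite /g; case: pselect => // Xa'.
  congr existT; exact: matching_eq.
pose g (B : tree) : {B : T & @hom T X B} :=
  if pselect (prunes X B) is left XB then existT (@hom T X) B (pruning XB)
  else existT (@hom T X) X (matching_id X).
apply: sub_finite_set (finite_image g (finite_prunings X)) => -[B e] /= /tree_epiP e0.
have XB := pruning_prunes e0; exists B => //; rewrite /g; case: pselect => // XB'.
congr existT; exact: matching_eq.
Qed.

(** One half of A8. Two subtrees of [Z] that share a subtree have addresses beginning a common word,
    so one address extends the other, and the extension [s] is the occurrence sought. *)
Lemma nested_occurrences W X Y Z (a : @hom T W X) (b : @hom T W Y) (c : @hom T X Z)
    (d : @hom T Y Z) s :
  is_occurrence c -> is_occurrence d ->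
  match_address c = match_address d ++ s -> c ∘ a = d ∘ b ->
  exists h : @hom T X Y, h ∘ a = b /\ d ∘ h = c.
Proof.
move=> co do_ cs /(congr1 (@match_address _ _ _ _)).
rewrite !comp_occurrence_l // cs -catA => /cat_inj ab.
have dE := (occurrenceP d).1 do_; have cE := (occurrenceP c).1 co.
have Ys : pos Y s.
  by have := match_address_pos c; rewrite cs pos_catE dE => /andP[].
have YX : subtree Y s = X.
  by rewrite -dE -subtree_cat -?cs //; exact: match_address_pos.
have XY : prunes X (subtree Y s) by rewrite YX; exact: prunes_refl.
exists (matching_at Ys XY).
have ho : is_occurrence (matching_at Ys XY) by exact/occurrenceP.
by split; apply: matching_eq; rewrite comp_occurrence_l.
Qed.

Lemma tree_nine_axioms : nine_axioms (leaf : T).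
Proof.
split.
- exact: leaf_terminal.
- move=> X Y f; exists _, (pruning (match_address_prunes f)),
    (subtree_occ (match_address_pos f)).
  split; [exact/tree_epiP|exact/tree_strongP|].
  by apply: matching_eq; rewrite comp_pruning_r.
- move=> X Y B d v /tree_epiP d0 /tree_strongP vo.
  have vY := match_address_pos v; have XY := pruning_prunes d0.
  have Xv := prunes_pos XY vY.
  have XB : prunes (subtree X (match_address v)) B.
    by have := prunes_subtree_pos XY vY; rewrite ((occurrenceP v).1 vo).
  exists _, (subtree_occ Xv), (pruning XB).
  by split; [exact: tree_pullback|exact/tree_epiP].
- move=> A X B u a us ae; have [Y [c [v [po vs pb _ _]]]] := tree_A4 us ae.
  by exists Y, c, v.
- exact: tree_A5.
- exact: tree_A6.
- exact: tree_A7.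
- move=> W X Y Z a b c d /tree_strongP ao /tree_strongP bo /tree_strongP co
    /tree_strongP do_ cd.
  have := congr1 (@match_address _ _ _ _) cd; rewrite !comp_occurrence_l // => E.
  have [/prefixP [s sE]|/prefixP [s sE]] :
      prefix (match_address d) (match_address c) \/
      prefix (match_address c) (match_address d).
  + by apply: prefix_comparable E.
  + by left; exact: nested_occurrences sE cd.
  by right; exact: nested_occurrences sE (esym cd).
move=> X Y d /tree_epiP d0 dj; apply: pruning_identity => //.
apply: prunes_eq; first exact: pruning_prunes d0.
move=> a Ya Yl; have lY : prunes leaf (subtree Y a) by rewrite Yl; constructor.
exact: (tree_pullback_iso_at (matching_at Ya lY) d0).1 (dj _).
Qed.

End Trees.

Theorem theorem1p37 :
  (forall (C : category) (one : C), nine_axioms one ->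
    exists F : functor C (tree_cat (@Phi_ar C one)),
      is_cat_iso F /\
      (forall (A X : C) (m : hom A X),
        strong_mono m <-> is_occurrence (fmap F m)) /\
      (forall (X Y : C) (e : hom X Y),
        epi e <-> is_pruning (fmap F e))) /\
  (forall (L : Type) (ar : L -> nat),
    nine_axioms (C := tree_cat ar) leaf).
Proof.
split; last exact: tree_nine_axioms.
move=> C one ax; pose H := tree_functor ax.
have Hi : injective H := @obj_of_inj C one ax.
have Hs : forall X, exists Y, H Y = X := @obj_of_surj C one ax.
have Hf : forall X Y (f : hom (H X) (H Y)),
  exists2 m : hom X Y, fmap H m = f & forall m', fmap H m' = f -> m' = m.
  exact: hom_of_bij.
have [F [FH HF]] := bijective_functor_inverse Hi Hs Hf.
exists F; split; [by exists H|split=> [A X m|X Y e]].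
  rewrite -tree_strongP -(bijective_functor_strong Hs Hf).
  by rewrite -(functor_eq_id_strong m HF).
rewrite -tree_epiP -(bijective_functor_epi Hs Hf).
by rewrite -(functor_eq_id_epi e HF).
Qed.
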